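(* Let $G$ be a finite group with $\gamma(G)=2$. Then $G\in\mathcal{C}$ if and only if $G\cong S_3\times\mathbb{Z}_q$, where $q\geq 5$ is a prime number.
   Context: For a finite group $G$, $L(G)$ denotes the set (lattice) of all subgroups of $G$, and $\gamma(G)$ denotes the number of conjugacy classes of non-normal subgroups of $G$. For $H\in L(G)$, the relative subgroup commutativity degree of $H$ in $G$ is $$sd(H,G)=\frac{1}{|L(H)||L(G)|}\left|\{(H_1,G_1)\in L(H)\times L(G) \mid H_1G_1=G_1H_1\}\right|.$$ Let $f:L(G)\to[0,1]$, $f(H)=sd(H,G)$. The class $\mathcal{C}$ consists of all finite groups $G$ for which $|\mathrm{Im}\, f|=2$, i.e. for which $f$ takes exactly two distinct values. $S_3$ is the symmetric group on three letters and $\mathbb{Z}_q$ is the cyclic group of order $q$. *)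

(* Defs.v *)
From mathcomp Require Import all_boot all_order all_algebra all_fingroup.

Set Implicit Arguments.
Unset Strict Implicit.
Unset Printing Implicit Defensive.

Import GroupScope GRing.Theory.

Section SubgroupCommutativity.

Variable gT : finGroupType.
Implicit Types G H : {group gT}.

Definition nonnormal_subgroups G : {set {group gT}} :=
  [set H in subgroups G | ~~ (H <| G)].

Definition gamma G : nat :=
  #|[set orbit 'JG G H | H in nonnormal_subgroups G]|.

Definition permuting_pairs H G : {set {group gT} * {group gT}} :=
  [set P in setX (subgroups H) (subgroups G) | P.1 * P.2 == P.2 * P.1].

Definition sd H G : rat :=
  (#|permuting_pairs H G|%:R / (#|subgroups H|%:R * #|subgroups G|%:R))%R.

(* The codomain rat is not a finType, so the image is a duplicate-free list. *)
Definition sd_image G : seq rat := undup [seq sd H G | H in subgroups G].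

Definition in_class_C G : Prop := size (sd_image G) = 2.

End SubgroupCommutativity.

(* Main.v *)
Require Import Defs.
From mathcomp Require Import all_boot all_order all_algebra all_fingroup.
From mathcomp Require Import all_solvable.
From mathcomp Require Import zify.

(* Let np(B) be the number of subgroups of G that do not permute with B, and let
   the defect d(Y) be the sum of np(B) over the subgroups B of Y. Then
   sd(Y, G) = 1 - d(Y) / (|L(Y)| |L(G)|) and sd(1, G) = 1, so G is in class C
   iff d is not identically 0 and d(Y) / |L(Y)| takes a single nonzero value.
   When gamma(G) = 2, with classes represented by H and K,
     d(Y) = n_H(Y) np(H) + n_K(Y) np(K),
   where n_B(Y) counts the conjugates of B contained in Y. Two consequences
   drive the proof. A normal subgroup M containing all nonpermutable subgroups
   has d(M) = d(G), hence |L(M)| = |L(G)| and M = G. And if all proper subgroups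
   of H permute with every subgroup while np(H) > 0, then
   n_H(Y) |L(H)| = |L(Y)| for every Y containing conjugates of H but none of K.

   If G is nilpotent, a nonnormal subgroup lies in a proper normal subgroup, so
   neither of H, K contains a conjugate of the other. They are then cyclic
   p-groups with a common maximal subgroup F, normal in G, and |G : F| = p^3.
   For p odd, G / F contains a further nonnormal subgroup of order p. For p = 2,
   counting subgroups gives |L(G)| < 4 |L(H)|, whereas class C requires equality.

   Otherwise some Sylow p-subgroup P is nonnormal. By the Frattini argument
   normal overgroups of P together with N_G(P) generate G, which leaves few
   possibilities for the second class. Each of them reduces to a group A ><| P
   with A of prime order r and P cyclic, in which the second consequence reads
   r l + 1 = 2 l + r for l = |L(P)|, i.e. (r - 2)(l - 1) = 1: this is S_3. Only
   the case where the second class is that of N_G(P) = P x R survives. *)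

Import GroupScope.

Set Implicit Arguments.
Unset Strict Implicit.
Unset Printing Implicit Defensive.

(** * Defects of permutability and the class C *)

Section Defect.

Variable gT : finGroupType.
Implicit Types A B C D G H K M N P Q R S X Y Z : {group gT}.

Definition nonperm G B : nat := #|[set C in subgroups G | B * C != C * B]|.

Definition defect G Y : nat := \sum_(B in subgroups Y) nonperm G B.

Definition nconj G H Y : nat := #|[set B in orbit 'JG G H | B \subset Y]|.

Lemma mem_subgroups G B : (B \in subgroups G) = (B \subset G).
Proof. by rewrite inE. Qed.

Lemma subgroups_gt0 G : 0 < #|subgroups G|.
Proof. by apply/card_gt0P; exists G; rewrite mem_subgroups. Qed.

Lemma card_subgroupsS M G : M \subset G -> #|subgroups G| <= #|subgroups M| -> G \subset M.
Proof.
move=> sMG le; have sS: subgroups M \subset subgroups G.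
  by apply/subsetP=> B; rewrite !mem_subgroups => /subset_trans; apply.
have /eqP e : subgroups M == subgroups G by rewrite eqEcard sS.
by rewrite -mem_subgroups e mem_subgroups.
Qed.

Lemma card_permuting_pairs G Y :
  #|permuting_pairs Y G| + defect G Y = (#|subgroups Y| * #|subgroups G|)%N.
Proof.
rewrite -cardsX -[RHS](cardsID [set P : {group gT} * {group gT} | P.1 * P.2 == P.2 * P.1]).
congr (_ + _).
  by apply: eq_card => P; rewrite !inE andbC.
rewrite /defect -sum1_card.
rewrite (eq_bigl (fun P : {group gT} * {group gT} =>
   (P.1 \in subgroups Y) && ((P.2 \in subgroups G) && (P.1 * P.2 != P.2 * P.1)))).
  rewrite -(pair_big_dep (fun B => B \in subgroups Y)
    (fun B C => (C \in subgroups G) && (B * C != C * B)) (fun _ _ => 1%N)) /=.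
  by apply: eq_bigr => B _; rewrite sum1dep_card; apply: eq_card => C; rewrite !inE.
by case=> B C; rewrite in_setD in_setX inE andbC -andbA.
Qed.

(** The factor |L(G)| cancels, and passing to the nonpermuting pairs turns equality of degrees into
    an identity between natural numbers. *)
Lemma eq_sd G Y Z :
  (sd Y G == sd Z G) = (defect G Y * #|subgroups Z| == defect G Z * #|subgroups Y|)%N.
Proof.
have gt0 (X : {group gT}) : (#|subgroups X|%:R : rat) != 0%R.
  by rewrite Num.Theory.pnatr_eq0 -lt0n subgroups_gt0.
rewrite /sd GRing.eqr_div ?GRing.mulf_neq0 // -!GRing.natrM Num.Theory.eqr_nat.
have eY := card_permuting_pairs G Y; have eZ := card_permuting_pairs G Z.
move: eY eZ (subgroups_gt0 G); move: (#|permuting_pairs Y G|) (#|permuting_pairs Z G|).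
move: (defect G Y) (defect G Z) (#|subgroups G|) (#|subgroups Y|) (#|subgroups Z|).
move=> dY dZ g y z a b ea eb g0.
rewrite mulnA [(b * _)%N]mulnA eqn_pmul2r //.
(* Both (a + dY) z and (b + dZ) y equal y z g. *)
apply/eqP/eqP; nia.
Qed.

Lemma defect1 G : defect G 1%G = 0.
Proof.
apply: big1 => B; rewrite mem_subgroups => sB1.
apply/eqP; rewrite cards_eq0; apply/eqP/setP=> C; rewrite !inE.
have /trivgP -> := sB1; by rewrite mul1g mulg1 eqxx andbF.
Qed.

(** The trivial subgroup always yields the value 1, so having two values means having exactly one
    more, taken precisely where the defect is positive. *)
Lemma in_class_CP G : in_class_C G <->
  (exists2 Y : {group gT}, Y \subset G & 0 < defect G Y) /\
  (forall Y Z : {group gT}, Y \subset G -> Z \subset G -> 0 < defect G Y -> 0 < defect G Z ->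
     (defect G Y * #|subgroups Z| = defect G Z * #|subgroups Y|)%N).
Proof.
rewrite /in_class_C /sd_image.
set s := undup _.
have Us : uniq s by apply: undup_uniq.
have ms r : reflect (exists2 Y : {group gT}, Y \subset G & r = sd Y G) (r \in s).
  rewrite mem_undup; apply: (iffP imageP) => [] [Y]; rewrite ?inE => sY ->; exists Y;
    rewrite ?inE //.
have sd1 (Y : {group gT}) : (sd Y G == sd 1 G) = (defect G Y == 0).
  by rewrite (eq_sd G Y 1%G) defect1 mul0n muln_eq0 [#|_| == _]eqn0Ngt subgroups_gt0 orbF.
have s1 : sd 1 G \in s by apply/ms; exists 1%G; rewrite ?sub1G.
split.
  move=> sz2.
  have [a [b [neq es]]] : exists a b, a != b /\ s = [:: a; b].
    move: Us sz2; case: s {ms s1} => [|a [|b []]] //= /andP[]; rewrite inE => nab _ _.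
    by exists a, b.
  have key (Y Z : {group gT}) : Y \subset G -> Z \subset G -> 0 < defect G Y -> 0 < defect G Z ->
    sd Y G = sd Z G.
    move=> sY sZ; rewrite !lt0n -!sd1.
    have : sd Y G \in s by apply/ms; exists Y.
    have : sd Z G \in s by apply/ms; exists Z.
    move: s1; rewrite es !inE.
    by case/orP=> /eqP-> /orP[]/eqP-> /orP[]/eqP->; rewrite ?eqxx.
  split; last by move=> Y Z sY sZ dY dZ; apply/eqP; rewrite -eq_sd; apply/eqP/key.
  have [c cs nc] : exists2 c, c \in s & c != sd 1 G.
    have [e|ne] := eqVneq a (sd 1 G); [exists b|exists a];
      rewrite ?es ?inE ?eqxx ?orbT // -e eq_sym //.
  by have /ms[Y sY ec] := cs; exists Y => //; rewrite lt0n -sd1 -ec.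
case=> [[Y sY dY] key].
have -> : 2 = size [:: sd 1 G; sd Y G] by [].
apply: perm_size; apply: uniq_perm => //.
  by rewrite /= inE eq_sym sd1 -lt0n dY.
move=> r; rewrite !inE; apply/ms/orP.
  case=> Z sZ ->; case: (posnP (defect G Z)) => [|dZ]; first by move/eqP; rewrite -sd1; left.
  by right; rewrite eq_sd key.
by case=> /eqP->; [exists 1%G; rewrite ?sub1G | exists Y].
Qed.

End Defect.

(** * Conjugacy classes of non-normal subgroups *)

Section Conjugates.

Variable gT : finGroupType.
Implicit Types A B C D G H K M N P Q R S X Y Z : {group gT}.

Lemma conjsP G H B : reflect (exists2 x, x \in G & B = (H :^ x)%G) (B \in orbit 'JG G H).
Proof. by apply: (iffP orbitP) => [] [x Gx e]; exists x. Qed.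

Lemma conjs_sym G H K : (H \in orbit 'JG G K) = (K \in orbit 'JG G H).
Proof. exact: orbit_sym. Qed.

Lemma conjs_sub G H B : B \in orbit 'JG G H -> (B \subset G) = (H \subset G).
Proof. by case/conjsP=> x Gx ->; rewrite /= -{1}(conjGid Gx) conjSg. Qed.

Lemma conjs_normal G H B : B \in orbit 'JG G H -> (B <| G) = (H <| G).
Proof. by case/conjsP=> x Gx ->; rewrite /= -{1}(conjGid Gx) normalJ. Qed.

Lemma conjs_card G H B : B \in orbit 'JG G H -> #|B| = #|H|.
Proof. by case/conjsP=> x Gx ->; rewrite cardJg. Qed.

Lemma conjs_subnormal G H B M : M <| G -> B \in orbit 'JG G H ->
  (B \subset M) = (H \subset M).
Proof.
case/andP=> _ nMG /conjsP[x Gx ->].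
by rewrite /= -{1}(normsP nMG x Gx) conjSg.
Qed.

Lemma conjs_nonperm G H B : B \in orbit 'JG G H -> nonperm G B = nonperm G H.
Proof.
case/conjsP=> x Gx ->; rewrite /nonperm.
rewrite -[RHS](card_imset _ (act_inj 'JG x)); apply: eq_card => C.
rewrite inE; apply/andP/imsetP => [[]|[D]].
  rewrite mem_subgroups => sCG nC; exists (C :^ x^-1)%G; last by apply/val_inj; rewrite /= conjsgKV.
  rewrite inE mem_subgroups /= sub_conjg invgK conjGid // sCG -(inj_eq (@conjsg_inj _ x)).
  by rewrite !conjsMg conjsgKV.
rewrite inE mem_subgroups => /andP[sDG nD] ->; rewrite mem_subgroups /=.
rewrite -(conjGid Gx) conjSg; split=> //.
by rewrite -!conjsMg (inj_eq (@conjsg_inj _ x)).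
Qed.

Lemma normal_nonperm G B : B <| G -> nonperm G B = 0.
Proof.
case/andP=> _ nBG; apply/eqP; rewrite cards_eq0; apply/eqP/setP=> C.
rewrite !inE; apply/negP=> /andP[sCG /eqP[]].
by apply/esym/normC; apply: subset_trans nBG.
Qed.

Lemma nonperm_gt0 G B C : C \subset G -> B * C != C * B -> 0 < nonperm G B.
Proof. by move=> sCG nBC; apply/card_gt0P; exists C; rewrite !inE sCG. Qed.

Lemma nonperm_gt0P G B :
  reflect (exists2 C : {group gT}, C \subset G & B * C != C * B) (0 < nonperm G B).
Proof.
apply: (iffP card_gt0P) => [[C]|[C sC nC]]; last by exists C; rewrite !inE sC.
by rewrite !inE => /andP[sC nC]; exists C.
Qed.

Lemma conjs_neq G H : H \subset G -> ~~ (H <| G) -> exists2 x, x \in G & H :^ x != H.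
Proof.
move=> sHG; rewrite /normal sHG /= => /subsetPn[x Gx]; rewrite inE => nx.
by exists x => //; apply: contra nx => /eqP->.
Qed.

(** A permuting product PQ is a p-subgroup containing P, so it cannot exceed P. *)
Lemma pgroup_permuting_Sylow p G P Q : p.-Sylow(G) P -> p.-group Q -> Q \subset G ->
  P * Q = Q * P -> Q \subset P.
Proof.
move=> sylP pQ sQG com.
have sP : P <*> Q \subset G by rewrite join_subG (pHall_sub sylP).
have pJ : p.-group (P <*> Q) by rewrite (comm_joingE com) pgroupM (pHall_pgroup sylP).
have e := sub_pHall sylP pJ (joing_subl P Q) sP.
by rewrite -e joing_subr.
Qed.

(** A Sylow subgroup never permutes with a different conjugate of itself. *)
Lemma Sylow_nonperm_gt0 p G P : p.-Sylow(G) P -> ~~ (P <| G) -> 0 < nonperm G P.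
Proof.
move=> sylP nP; have sPG := pHall_sub sylP.
have [x Gx nx] := conjs_neq sPG nP.
apply: (@nonperm_gt0 _ _ (P :^ x)%G); first by rewrite /= -(conjGid Gx) conjSg.
apply: contra nx => /eqP com; rewrite eqEcard cardJg leqnn andbT.
apply: (pgroup_permuting_Sylow sylP) com; first by rewrite pgroupJ (pHall_pgroup sylP).
by rewrite /= -(conjGid Gx) conjSg.
Qed.

Lemma normal_Sylow_mulN p G P M : p.-Sylow(G) P -> M <| G -> P \subset M -> M * 'N_G(P) = G.
Proof.
by move=> sylP nM sPM; apply: (Frattini_arg nM (pHall_subl sPM (normal_sub nM) sylP)).
Qed.

(** If M were normal, the Frattini argument would give G = M N_G(P) = N_G(P). *)
Lemma Sylow_normalizer_nonnormal p G P M : p.-Sylow(G) P -> ~~ (P <| G) ->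
  P \subset M -> M \subset 'N_G(P) -> ~~ (M <| G).
Proof.
move=> sylP nP sPM sMN; apply: contra nP => nM.
have e := normal_Sylow_mulN sylP nM sPM.
have : G \subset 'N_G(P) by rewrite -{1}e mul_subG.
by rewrite subsetI /normal (pHall_sub sylP) => /andP[].
Qed.

Definition two_classes G H K :=
  [/\ H \in nonnormal_subgroups G, K \in nonnormal_subgroups G, K \notin orbit 'JG G H
    & forall B, B \in nonnormal_subgroups G -> (B \in orbit 'JG G H) || (B \in orbit 'JG G K)].

Lemma nonnormalP G B : (B \in nonnormal_subgroups G) = (B \subset G) && ~~ (B <| G).
Proof. by rewrite inE mem_subgroups. Qed.

Lemma two_classes_sym G H K : two_classes G H K -> two_classes G K H.
Proof.
case=> nH nK nHK cov; split; rewrite ?[H \in _]conjs_sym //.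
by move=> B nB; rewrite orbC cov.
Qed.

Lemma two_classes_sub G H K : two_classes G H K ->
  (H \subset G) /\ ~~ (H <| G).
Proof. by case; rewrite nonnormalP => /andP. Qed.

Lemma gamma2_classes G : gamma G = 2 -> exists H K, two_classes G H K.
Proof.
move/eqP/cards2P=> [C [D [neCD e]]].
have : C \in [set C; D] by rewrite !inE eqxx.
have : D \in [set C; D] by rewrite !inE eqxx orbT.
rewrite -e => /imsetP[K nK eD] /imsetP[H nH eC]; exists H, K; split=> //.
  by apply: contra neCD; rewrite eC eD orbit_sym => /orbit_eqP->.
move=> B nB; have : orbit 'JG G B \in [set C; D] by rewrite -e imset_f.
by rewrite !inE eC eD => /orP[]/eqP eB; rewrite -eB orbit_refl ?orbT.
Qed.

(** Pigeonhole: among A, B and C two share a class, and these are not A and B. *)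
Lemma two_classes_repl G H K A B : two_classes G H K ->
  A \in nonnormal_subgroups G -> B \in nonnormal_subgroups G ->
  B \notin orbit 'JG G A -> two_classes G A B.
Proof.
case=> nH nK nHK cov nA nB nAB; split=> // C nC.
have := cov A nA; have := cov B nB; have := cov C nC.
have tr X Y Z : X \in orbit 'JG G Y -> Z \in orbit 'JG G Y -> X \in orbit 'JG G Z.
  by move=> XY; rewrite conjs_sym; apply: orbit_trans XY.
case/orP=> cC; case/orP=> cB; case/orP=> cA;
  by [rewrite (tr _ _ _ cC cA) | rewrite (tr _ _ _ cC cB) orbT | rewrite (tr _ _ _ cB cA) in nAB].
Qed.

Lemma two_classes_conj G H K A : two_classes G H K -> A \in orbit 'JG G H -> two_classes G A K.
Proof.
move=> tc cA; have [nH nK nHK _] := tc; apply: (two_classes_repl tc) => //.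
  by rewrite nonnormalP (conjs_sub cA) (conjs_normal cA) -nonnormalP.
by apply: contra nHK => /orbit_eqP; rewrite (orbit_eqP cA) => <-; apply: orbit_refl.
Qed.

(** Normal subgroups contribute 0, and [nonperm] is constant along each class. *)
Lemma defect_two_classes G H K Y : two_classes G H K -> Y \subset G ->
  defect G Y = (nconj G H Y * nonperm G H + nconj G K Y * nonperm G K)%N.
Proof.
case=> nH nK nHK cov sYG.
rewrite /defect (bigID (fun B => B \in orbit 'JG G H)) /=; congr (_ + _).
  rewrite (eq_bigr (fun=> nonperm G H)) => [|B /andP[_ cB]]; last exact: conjs_nonperm.
  rewrite sum_nat_const; congr (_ * _)%N; apply: eq_card => B.
  by rewrite [RHS]inE [LHS]inE mem_subgroups andbC.
rewrite (bigID (fun B => B \in orbit 'JG G K)) /= [X in (_ + X)%N]big1 ?addn0.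
  rewrite (eq_bigr (fun=> nonperm G K)) => [|B /andP[_ cB]]; last exact: conjs_nonperm.
  rewrite sum_nat_const; congr (_ * _)%N; apply: eq_card => B.
  rewrite [RHS]inE [LHS]inE mem_subgroups -andbA andbC; case cB: (B \in orbit 'JG G K);
    rewrite ?andbF //.
  rewrite andbT (_ : B \notin orbit 'JG G H) //; apply: contra nHK => /orbit_eqP <-.
  by rewrite conjs_sym.
move=> B /andP[/andP[]]; rewrite mem_subgroups => sBY nBH nBK.
apply: normal_nonperm; apply: contraNT nBH => nB.
have := cov B; rewrite nonnormalP nB (subset_trans sBY sYG) (negPf nBK) orbF; exact.
Qed.

Lemma nconj_normal G H M : M <| G -> H \subset M -> nconj G H M = #|orbit 'JG G H|.
Proof.
move=> nM sHM; apply: eq_card => B; rewrite inE; case cB: (B \in _) => //=.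
by rewrite (conjs_subnormal nM cB) sHM.
Qed.

Lemma card_conjs G H : #|orbit 'JG G H| = #|G : 'N_G(H)|.
Proof. by rewrite card_orbit /= astab1JG. Qed.

Lemma nconj_eq0 G H Y : (forall B, B \in orbit 'JG G H -> ~~ (B \subset Y)) -> nconj G H Y = 0.
Proof.
move=> nY; apply/eqP; rewrite cards_eq0; apply/eqP/setP=> B; rewrite !inE.
by apply/negP=> /andP[/nY/negP].
Qed.

Lemma nconj_normal0 G H M : M <| G -> ~~ (H \subset M) -> nconj G H M = 0.
Proof. by move=> nM nHM; apply: nconj_eq0 => B cB; rewrite (conjs_subnormal nM cB). Qed.

Lemma nconj_id G H : nconj G H H = 1%N.
Proof.
rewrite -(cards1 H); apply: eq_card => B; rewrite !inE.
apply/andP/eqP=> [[cB sB]|->]; last by rewrite orbit_refl subxx.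
by apply/val_inj/eqP; rewrite /= eqEcard sB (conjs_card cB) leqnn.
Qed.

Lemma defect_minimal G B : (forall C, C \subset B -> C :!=: B -> nonperm G C = 0) ->
  defect G B = nonperm G B.
Proof.
move=> min; rewrite /defect (bigD1 B) ?mem_subgroups //= big1 ?addn0 // => C.
by rewrite mem_subgroups => /andP[sC nC]; apply: min.
Qed.

(** Subgroups outside M add nothing to the defect, so M and G have equal defects and, by the class
    condition, equally many subgroups. *)
Lemma class_C_normal_cover G M : in_class_C G -> M <| G ->
  (forall B, B \subset G -> 0 < nonperm G B -> B \subset M) -> M :=: G.
Proof.
case/in_class_CP=> [[Y sYG dY] key] nM cov; have sMG := normal_sub nM.
have eD : defect G M = defect G G.
  rewrite /defect [RHS](bigID (fun B : {group gT} => B \subset M)) /=.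
  rewrite [X in (_ + X)%N]big1 ?addn0 => [|B]; last first.
    rewrite mem_subgroups => /andP[sB nB]; apply/eqP; rewrite eqn0Ngt.
    by apply: contra nB; apply: cov.
  apply: eq_bigl => B; rewrite !mem_subgroups andbC.
  by case sB: (B \subset M) => //=; rewrite (subset_trans sB).
have dG : 0 < defect G G.
  apply: leq_trans dY _; rewrite [defect G G]/defect (bigID (fun B : {group gT} => B \subset Y)) /=.
  rewrite [X in _ <= X + _](eq_bigl (fun B => B \in subgroups Y)) ?leq_addr // => B.
  by rewrite !mem_subgroups andbC; case sB: (B \subset Y) => //=; rewrite (subset_trans sB).
have := key M G sMG (subxx _); rewrite eD => /(_ dG dG)/eqP; rewrite eqn_pmul2l // => /eqP e.
by apply/eqP; rewrite eqEsubset sMG card_subgroupsS ?e.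
Qed.

(** This fixes the reference value of the ratio: the defect of B is its single term at B. *)
Lemma class_C_ratio G B Y : in_class_C G -> B \subset G -> Y \subset G ->
  0 < nonperm G B -> (forall C, C \subset B -> C :!=: B -> nonperm G C = 0) ->
  0 < defect G Y ->
  (defect G Y * #|subgroups B| = nonperm G B * #|subgroups Y|)%N.
Proof.
case/in_class_CP=> [_ key] sBG sYG nB min dY.
by rewrite -(defect_minimal min) key // (defect_minimal min).
Qed.

End Conjugates.

(** * Counting subgroups of cyclic p-groups, direct products and split products *)

Section Counting.

Variable gT : finGroupType.
Implicit Types A B C D F G H K M N P Q R S X Y Z : {group gT}.

(** A subgroup of a cyclic p-group is determined by its order, and every power of p up to |P|
    occurs. *)
Lemma card_subgroups_cyclic_pgroup (p : nat) P : p.-group P -> cyclic P ->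
  #|subgroups P| = (logn p #|P|).+1.
Proof.
move=> pP cycP; set n := logn p #|P|.
have logle B : B \subset P -> logn p #|B| < n.+1.
  by move=> sB; rewrite ltnS dvdn_leq_log // cardSg.
pose f B : 'I_n.+1 := inord (logn p #|B|).
have injf : {in subgroups P &, injective f}.
  move=> B C; rewrite !mem_subgroups => sB sC /(congr1 val).
  rewrite /= !inordK ?logle // => e; apply/val_inj/eqP.
  rewrite /= (eq_subG_cyclic cycP) // (card_pgroup (pgroupS sB pP)).
  by rewrite (card_pgroup (pgroupS sC pP)) e.
rewrite -(card_in_imset injf) -[RHS]card_ord; apply: eq_card => i.
rewrite [RHS]inE; apply/imsetP.
have [Q [sQ _ oQ]] := normal_pgroup pP (normal_refl P) (ltn_ord i : i <= n).
exists Q; first by rewrite mem_subgroups.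
apply: val_inj; rewrite /= inordK ?logle // oQ.
(* For trivial P nothing makes p prime, but then the only exponent is 0. *)
case: (eqVneq P 1%G) => [P1|ntP]; last first.
  by have [|pr _ _] := pgroup_pdiv pP; rewrite ?pfactorK.
have n0 : n = 0 by rewrite /n P1 cards1 logn1.
by move: (nat_of_ord i) (ltn_ord i) => j; rewrite n0 ltnS leqn0 => /eqP->; rewrite expn0 logn1.
Qed.

(** Inside a cyclic group containment is divisibility of orders. *)
Lemma cyclic_pgroup_max (p : nat) P : p.-group P -> cyclic P -> P :!=: 1 ->
  exists F, [/\ F \subset P, (#|P| = p * #|F|)%N &
    forall B, B \subset P -> (B \subset F) = (B :!=: P)].
Proof.
move=> pP cycP ntP; have [pr pdv [m oP]] := pgroup_pdiv pP ntP.
have [|F [sF _ oF]] := @normal_pgroup _ _ m _ _ pP (normal_refl P).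
  by rewrite oP pfactorK.
exists F; split=> //; first by rewrite oP oF expnS.
move=> B sB; rewrite -(cardSg_cyclic cycP) // (eq_subG_cyclic cycP) // oF oP.
have /dvdn_pfactor-/(_ pr)[i lei ->] : #|B| %| p ^ m.+1 by rewrite -oP cardSg.
by rewrite dvdn_Pexp2l ?eqn_exp2l ?prime_gt1 // -ltnS ltn_neqAle lei andbT.
Qed.

Lemma card_subgroups_max P F : F \subset P -> F :!=: P ->
  (forall B, B \subset P -> B :!=: P -> B \subset F) ->
  #|subgroups P| = #|subgroups F|.+1.
Proof.
move=> sF nF max; rewrite (cardsD1 P) mem_subgroups subxx add1n; congr _.+1.
apply: eq_card => B; rewrite !inE.
apply/andP/idP=> [[nB sB]|sB]; first by apply: max.
rewrite (subset_trans sB sF); split=> //.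
by apply: contra nF => /eqP e; rewrite eqEsubset sF -e.
Qed.

(** The components of y in A and B are constituents, hence powers, of y and so stay in Y. *)
Lemma coprime_dprod_sub A B G Y : A \x B = G -> coprime #|A| #|B| ->
  Y \subset G -> (Y :&: A) \x (Y :&: B) = Y.
Proof.
move=> dG co sY; have [_ mulAB cAB tiAB] := dprodP dG.
have nA : A <| G by case/dprod_normal2: dG.
have nB : B <| G by case/dprod_normal2: dG.
have piA := pgroup_pi A.
have piB : \pi(A)^'.-group B by rewrite /pgroup -coprime_pi' // cardG_gt0.
have [hA hB] := coprime_mulpG_Hall mulAB piA piB.
have sub : Y \subset (Y :&: A) * (Y :&: B).
  apply/subsetP=> y Yy; have Gy := subsetP sY y Yy.
  have Yc pi : y.`_pi \in Y by apply: subsetP (cycle_constt pi y); rewrite cycle_subG.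
  have Gc pi : y.`_pi \in G by apply: (subsetP sY).
  rewrite -(consttC \pi(A) y) mem_mulg // inE Yc /=.
    by rewrite (mem_normal_Hall hA) ?p_elt_constt.
  by rewrite (mem_normal_Hall hB) ?p_elt_constt.
rewrite dprodE.
- by apply/eqP; rewrite eqEsubset sub mul_subG ?subsetIl.
- by apply: subset_trans (centS (subsetIr Y A)); apply: subset_trans (subsetIr Y B) cAB.
by apply/trivgP; rewrite -tiAB setISS ?subsetIr.
Qed.

(** Intersecting with A and with B is a bijection, inverse to forming the product of C and D. *)
Lemma card_subgroups_dprod A B G : A \x B = G -> coprime #|A| #|B| ->
  #|subgroups G| = (#|subgroups A| * #|subgroups B|)%N.
Proof.
move=> dG co; have [_ mulAB cAB tiAB] := dprodP dG.
rewrite -cardsX; pose f Y := ((Y :&: A)%G, (Y :&: B)%G).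
have injf : {in subgroups G &, injective f}.
  move=> Y Z; rewrite !mem_subgroups => sY sZ [eA eB]; apply/val_inj.
  by rewrite /= -(coprime_dprod_sub dG co sY) -(coprime_dprod_sub dG co sZ) eA eB.
rewrite -(card_in_imset injf); apply: eq_card => -[C D].
rewrite in_setX !mem_subgroups; apply/imsetP/andP=> [[Y sY [-> ->]]|[sC sD]].
  by rewrite !subsetIr.
have cCD : D \subset 'C(C) by apply: subset_trans sD (subset_trans cAB (centS sC)).
have e : C <*> D = C * D by rewrite cent_joinEr.
have tCB : C :&: B = 1 by apply/trivgP; rewrite -tiAB setSI.
have tDA : A :&: D = 1 by apply/trivgP; rewrite -tiAB setIS.
exists (C <*> D)%G.
  by rewrite mem_subgroups join_subG -mulAB (subset_trans sC) ?mulG_subl ?(subset_trans sD) ?mulG_subr.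
congr (_, _); apply/val_inj; rewrite /= e.
  by rewrite -group_modl // setIC tDA mulg1.
by rewrite setIC -group_modr // setIC tCB mul1g.
Qed.

Lemma card_subgroups_prime R : prime #|R| -> #|subgroups R| = 2.
Proof.
move=> pr; have pR : #|R|.-group R by apply: pnat_id.
by rewrite (card_subgroups_cyclic_pgroup pR (prime_cyclic pr)) (pfactorK 1).
Qed.

Lemma prime_index_normalizer Y P : P \subset Y -> prime #|Y : P| -> ~~ (P <| Y) ->
  'N_Y(P) = P.
Proof.
move=> sPY pr nP; have sPN : P \subset 'N_Y(P) by rewrite subsetI sPY normG.
have sNY : 'N_Y(P) \subset Y by apply: subsetIl.
have dv : #|'N_Y(P) : P| %| #|Y : P| by rewrite -(Lagrange_index sNY sPN) dvdn_mull.
have := primeP pr => -[_ /(_ _ dv)/orP[]/eqP e].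
  by apply/eqP; rewrite eqEsubset sPN -indexg_eq1 e.
case/negP: nP; rewrite /normal sPY; apply: subset_trans (subsetIr Y 'N(P)).
have /eqP := Lagrange_index sNY sPN; rewrite e -[X in _ == X]mul1n eqn_pmul2r ?prime_gt0 //.
by rewrite indexg_eq1.
Qed.

(* If F is the maximal subgroup of P, the subgroups of Y containing no conjugate
   of P are those of A x F. *)
Lemma card_subgroups_split (p : nat) A P Y :
    A <| Y -> P \subset Y -> A * P = Y -> prime #|A| -> p.-group P -> cyclic P ->
    ~~ (p %| #|A|) -> ~~ (P <| Y) -> (forall B, B \subset P -> B :!=: P -> B <| Y) ->
  #|orbit 'JG Y P| = #|A| /\ (#|subgroups Y| + 1 = 2 * #|subgroups P| + #|A|)%N.
Proof.
move=> nA sPY mulAP prA pP cycP npA nP maxP; have sAY := normal_sub nA.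
have ntP : P :!=: 1.
  by apply: contra nP => /eqP->; apply: normal1.
have [pr _ _] := pgroup_pdiv pP ntP.
have [F [sF oP maxF]] := cyclic_pgroup_max pP cycP ntP.
have nFP : F :!=: P by rewrite -maxF.
have nF : F <| Y by apply: maxP.
have p'A : p^'.-group A by rewrite p'groupEpi mem_primes pr cardG_gt0.
have coAP : coprime #|A| #|P| by rewrite coprime_sym; apply: pnat_coprime pP p'A.
have tiAP : A :&: P = 1 by apply: coprime_TIg.
have oY : #|Y| = (#|A| * #|P|)%N by rewrite -mulAP TI_cardMg.
have iYP : #|Y : P| = #|A| by rewrite -divgS // oY mulnK.
have NP : 'N_Y(P) = P by apply: prime_index_normalizer; rewrite ?iYP.
have oconj : #|orbit 'JG Y P| = #|A| by rewrite card_conjs NP.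
have [hA sylP] := coprime_mulGp_Hall mulAP p'A pP.
split=> //.
have tiAF : A :&: F = 1 by apply/trivgP; rewrite -tiAP setIS.
have cAF : F \subset 'C(A).
  rewrite centsC; apply/commG1P/trivgP; rewrite -tiAF commg_subI // subsetI subxx /=.
    by apply: subset_trans sAY (normal_norm nF).
  by apply: subset_trans (normal_sub nF) (normal_norm nA).
have dAF : A \x F = A <*> F by rewrite dprodEY.
have coAF : coprime #|A| #|F| by apply: coprime_dvdr coAP; apply: cardSg.
have nbAF := card_subgroups_dprod dAF coAF.
have sAFY : A <*> F \subset Y by rewrite join_subG sAY normal_sub.
have oAF : #|A <*> F| = (#|A| * #|F|)%N by rewrite -(dprod_card dAF).
have nPAF Q : Q \in orbit 'JG Y P -> ~~ (Q \subset A <*> F).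
  move=> cQ; apply/negP=> /cardSg; rewrite (conjs_card cQ) oAF Gauss_dvdr ?oP; last first.
    by rewrite -oP coprime_sym.
  by rewrite -{2}[#|F|]mul1n dvdn_pmul2r // dvdn1 eqn_leq leqNgt prime_gt1.
have nbP : #|subgroups P| = #|subgroups F|.+1.
  by apply: card_subgroups_max => // B sB; rewrite maxF.
(* If B contains a conjugate Q of P, it is Q or Y because |Y : Q| = |A| is prime. Otherwise the
   p-part of each element of B is conjugate into a proper subgroup of P, hence lies in F, while its
   p'-part lies in A. *)
have dich B : B \subset Y -> (B \subset A <*> F) || (B \in orbit 'JG Y P) || (B == Y).
  move=> sB; case hP: [exists Q in orbit 'JG Y P, gval Q \subset B].
    have /existsP[Q /andP[cQ sQB]] := hP.
    have sQY := subset_trans sQB sB; have oQ := conjs_card cQ.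
    have iYQ : (#|Y : B| * #|B : Q|)%N = #|A|.
      by rewrite Lagrange_index // -divgS // oQ oY mulnK.
    have dv : #|B : Q| %| #|A| by rewrite -iYQ dvdn_mull.
    have := primeP prA => -[_ /(_ _ dv)/orP[]/eqP e].
      have -> : B = Q by apply/val_inj/eqP; rewrite /= eqEsubset sQB -indexg_eq1 e.
      by rewrite cQ orbT.
    have /eqP := iYQ; rewrite e -{2}[#|A|]mul1n eqn_pmul2r // indexg_eq1 => sYB.
    by rewrite orbC -val_eqE /= eqEsubset sB sYB.
  rewrite -orbA; apply/orP; left; apply/subsetP=> b Bb; have Yb := subsetP sB b Bb.
  have cb pi : b.`_pi \in B by apply: subsetP (cycle_constt pi b); rewrite cycle_subG.
  rewrite -(consttC p b) groupM //; last first.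
    by rewrite (subsetP (joing_subl A F)) // (mem_normal_Hall hA nA) ?p_elt_constt // (subsetP sB).
  rewrite (subsetP (joing_subr A F)) // -cycle_subG.
  have sbY : <[b.`_p]> \subset Y by rewrite cycle_subG (subsetP sB).
  have [y Yy sby] := Sylow_subJ sylP sbY (p_elt_constt p b).
  rewrite -(normsP (normal_norm nF) y Yy) -sub_conjgV.
  rewrite (maxF (<[b.`_p]> :^ y^-1)%G) ?sub_conjgV //=.
  apply: contraFN hP => /eqP eP; apply/existsP; exists (P :^ y)%G.
  apply/andP; split; first by apply/conjsP; exists y.
  by rewrite /= -eP conjsgKV cycle_subG.
have nYAF : ~~ (Y \subset A <*> F).
  by apply: contra (nPAF P (orbit_refl _ _ _)); apply: subset_trans.
have nYP : Y \notin orbit 'JG Y P.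
  by apply/negP=> /conjs_card e; have := prime_gt1 prA; rewrite -iYP -divgS // e divnn cardG_gt0.
have eU : subgroups Y = Y |: (subgroups (A <*> F) :|: orbit 'JG Y P).
  apply/setP=> B; rewrite in_setU1 in_setU !mem_subgroups.
  apply/idP/idP=> [sB|]; first by rewrite orbC dich.
  case/or3P=> [/eqP->|sB|cB] //; first by apply: subset_trans sAFY.
  by rewrite (conjs_sub cB).
rewrite eU cardsU1 in_setU mem_subgroups (negPf nYAF) (negPf nYP) add1n.
rewrite cardsU (_ : _ :&: _ = set0) ?cards0 ?subn0.
  (* If F has f subgroups, then A x F has 2 f and P has f + 1; the |A| conjugates of P and Y itself
     complete the count. *)
  rewrite nbAF oconj card_subgroups_prime // nbP.
  by move: #|subgroups F| #|A|; clear => f a; lia.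
apply/setP=> B; rewrite !inE; apply/negP=> /andP[sB cB]; case/negP: (nPAF B cB); exact: sB.
Qed.

End Counting.

(** * Overgroups, normal complements and Sylow counts *)

Section General.

Variable gT : finGroupType.
Implicit Types A B C D F G H K L M N P Q R S T X Y Z : {group gT}.

(** The equation is (r - 2)(l - 1) = 1. *)
Lemma split_count r l : 2 <= r -> 2 <= l -> (r * l + 1 = 2 * l + r)%N -> r = 3 /\ l = 2.
Proof. by case: r => [|[|[|[|r]]]] //; case: l => [|[|[|l]]] //; nia. Qed.

Lemma subgroups_ge2 P : P :!=: 1 -> 2 <= #|subgroups P|.
Proof.
move=> nt; rewrite (cardD1 P) (cardD1 1%G) !inE sub1G subxx /= andbT.
by rewrite -val_eqE /= eq_sym nt.
Qed.

Lemma two_classes_overgroup G P L Y : two_classes G P L -> P \subset Y -> Y \subset G ->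
  [\/ Y = P, Y \in orbit 'JG G L | Y <| G].
Proof.
case=> _ _ _ cov sPY sYG; case nY: (Y <| G); first by constructor 3.
have /orP[cY|cY] : (Y \in orbit 'JG G P) || (Y \in orbit 'JG G L).
  by apply: cov; rewrite nonnormalP sYG nY.
  by constructor 1; apply/esym/val_inj/eqP; rewrite /= eqEcard sPY (conjs_card cY) leqnn.
by constructor 2.
Qed.

Lemma two_classes_normal G P L Y : two_classes G P L -> Y \subset G ->
  Y \notin orbit 'JG G P -> Y \notin orbit 'JG G L -> Y <| G.
Proof.
case=> _ _ _ cov sYG nP nL; apply: contraNT nP => nY.
by have := cov Y; rewrite nonnormalP sYG nY (negPf nL) orbF => ->.
Qed.

Lemma conj_card_eq G H B : B \in orbit 'JG G H -> B \subset H -> B = H.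
Proof. by move=> cB sB; apply/val_inj/eqP; rewrite /= eqEcard sB (conjs_card cB) leqnn. Qed.

(** If B is not cyclic, its cyclic subgroups are proper, hence normal in G, and B is their union. *)
Lemma cyclic_of_proper_normal G B : B \subset G -> ~~ (B <| G) ->
  (forall C, C \subset B -> C :!=: B -> C <| G) -> cyclic B.
Proof.
move=> sBG nB min; apply: contraNT nB => ncB; rewrite /normal sBG.
apply/subsetP=> g Gg; rewrite inE; apply/subsetP=> _ /imsetP[x Bx ->].
have /andP[_ nx] : <[x]> <| G.
  apply: min; rewrite ?cycle_subG //; apply: contra ncB => /eqP<-; exact: cycle_cyclic.
have : x ^ g \in <[x]> by rewrite memJ_norm ?cycle_id ?(subsetP nx).
by apply: subsetP; rewrite cycle_subG.
Qed.

(** The p'-core contains the normal Sylow q-subgroups for all q other than p, so its order is the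
    full p'-part of |G|. *)
Lemma normal_Sylows_Hall p G P : prime p -> p.-Sylow(G) P ->
    (forall q Q, prime q -> q != p -> q.-Sylow(G) Q -> Q <| G) ->
  exists S, [/\ S <| G, p^'.-Hall(G) S, S * P = G & S :&: P = 1].
Proof.
move=> prp sylP nQ; exists 'O_p^'(G)%G; have nS := pcore_normal p^' G.
have pS := pcore_pgroup p^' G.
have hS : p^'.-Hall(G) 'O_p^'(G).
  rewrite pHallE normal_sub // eqn_dvd.
  have -> : #|'O_p^'(G)| %| #|G|`_p^'.
    by rewrite -(part_pnat_id pS) partn_dvd ?cardG_gt0 // cardSg ?pcore_sub.
  apply/dvdn_partP => [|q]; first by rewrite part_gt0.
  rewrite pi_of_part ?cardG_gt0 // => /andP[/=]; rewrite mem_primes => /and3P[prq _ dq] neq.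
  have [Q sylQ] := Sylow_exists q G.
  rewrite partn_part; last by move=> r; rewrite !inE => /eqP->.
  rewrite -(card_Hall sylQ) cardSg // pcore_max ?(nQ q Q) //.
  by apply: pi_pgroup (pHall_pgroup sylQ) _.
have dG : 'O_p^'(G) ><| P = G by apply/(sdprod_normal_pHallP nS sylP); exact: hS.
have [_ mulSP _ tiSP] := sdprodP dG.
by split.
Qed.

(** Conjugates of P lying in Y are Sylow subgroups of Y, hence conjugate in Y. *)
Lemma nconj_Sylow p G P Y : p.-Sylow(G) P -> P \subset Y -> Y \subset G ->
  nconj G P Y = #|orbit 'JG Y P|.
Proof.
move=> sylP sPY sYG; have sylPY := pHall_subl sPY sYG sylP.
apply: eq_card => Q; rewrite inE; apply/andP/idP => [[cQ sQ]|cQ].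
  have sylQ : p.-Sylow(Y) Q.
    apply: pHall_subl sQ sYG _; have /conjsP[x Gx ->] := cQ.
    by rewrite /= pHallJ.
  by have [x Yx e] := Sylow_trans sylPY sylQ; apply/conjsP; exists x => //; apply/val_inj.
rewrite (conjs_sub cQ); split=> //; have /conjsP[x Yx ->] := cQ.
by apply/conjsP; exists x => //; apply: (subsetP sYG).
Qed.

Lemma commuting_normals G A B : A <| G -> B <| G -> A :&: B = 1 -> B \subset 'C(A).
Proof.
move=> nA nB ti; rewrite centsC; apply/commG1P/trivgP; rewrite -ti commg_subI // subsetI subxx /=.
  by apply: subset_trans (normal_sub nA) (normal_norm nB).
by apply: subset_trans (normal_sub nB) (normal_norm nA).
Qed.

(** By Sylow's congruence, 3 is 1 modulo p. *)
Lemma Syl3_mod p G P : prime p -> p.-Sylow(G) P -> #|orbit 'JG G P| = 3 -> p = 2.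
Proof.
move=> prp sylP o3; have := card_Syl_mod G prp; rewrite (card_Syl sylP) -card_conjs o3.
by case: p prp {sylP} => [|[|[|[|p]]]] //; rewrite modn_small.
Qed.

End General.

(** * Nonnormal Sylow subgroup P with N_G(P) in the second class *)

Section NormalizerBigger.

Variable gT : finGroupType.
Implicit Types A B C D F G H K L M N P Q R S T X Y Z : {group gT}.

(** An internal form of S_3 x Z_q: S_3 is the nonabelian group of order 6, and R is cyclic. *)
Definition split_S3 G := exists X R : {group gT},
  [/\ X \x R = G, #|X| = 6, ~~ abelian X, prime #|R| & 5 <= #|R|].

Variables (p : nat) (G P : {group gT}).
Hypotheses (prp : prime p) (sylP : p.-Sylow(G) P) (nP : ~~ (P <| G)).
Hypothesis (maxP : forall B, B \subset P -> B :!=: P -> B <| G).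

Let N := 'N_G(P)%G.

Hypotheses (nNP : N :!=: P) (tc : two_classes G P N) (cC : in_class_C G).

(** All subgroups of the normal p-complement S are normal in G, S is abelian, and coprime action
    separates A = [S, P] from R = C_S(P). The subgroup count applies to X = AP and makes it S_3. *)
Lemma big_normalizer_split : split_S3 G.
Proof.
have sPG := pHall_sub sylP; have pP := pHall_pgroup sylP.
have sPN : P \subset N by rewrite subsetI sPG normG.
have sNG : N \subset G by apply: subsetIl.
have ntP : P :!=: 1 by apply: contra nP => /eqP->; apply: normal1.
have dvp : p %| #|P| by have [] := pgroup_pdiv pP ntP.
have sylPN : p.-Sylow(N) P := pHall_subl sPN sNG sylP.
have cycP : cyclic P := cyclic_of_proper_normal sPG nP maxP.
(* Both class representatives have order divisible by p. *)
have p'normal B : B \subset G -> p^'.-group B -> B <| G.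
  move=> sB p'B; apply: (two_classes_normal tc) => //; apply/negP=> /conjs_card e.
    by move: p'B; rewrite /pgroup e p'natE // dvp.
  by move: p'B; rewrite /pgroup e p'natE // (dvdn_trans dvp) ?cardSg.
have [S [nS hS mulSP tiSP]] : exists S, [/\ S <| G, p^'.-Hall(G) S, S * P = G & S :&: P = 1].
  apply: (normal_Sylows_Hall prp sylP) => q Q prq neq sylQ.
  by apply: p'normal (pHall_sub sylQ) _; apply: pi_pgroup (pHall_pgroup sylQ) _.
have sSG := normal_sub nS; have p'S := pHall_pgroup hS.
have Snormal B : B \subset S -> B <| G.
  by move=> sB; apply: p'normal; [apply: subset_trans sSG | apply: pgroupS p'S].
have [R [sRN prR p'R]] : exists R, [/\ R \subset N, prime #|R| & p^'.-group R].
  have : #|N : P| != 1%N.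
    by rewrite indexg_eq1; apply: contra nNP => sNP; rewrite eqEsubset sNP.
  move/eqP=> i1; have [q prq dq] : exists2 q, prime q & q %| #|N : P|.
    by exists (pdiv #|N : P|);
      rewrite ?pdiv_dvd // pdiv_prime // ltn_neqAle eq_sym indexg_gt0 andbT; apply/eqP.
  have neq : q != p.
    apply: contraTneq dq => ->; rewrite -p'natE //.
    by have /and3P[] := sylPN.
  have dqN : q %| #|N| by rewrite -(Lagrange sPN) dvdn_mull.
  have [y Ny oy] := Cauchy prq dqN; exists <[y]>%G; split; rewrite ?cycle_subG -?orderE ?oy //.
  by rewrite /pgroup -orderE oy pnatE.
have nR : R <| G by apply: p'normal => //; apply: subset_trans sNG.
have sRS : R \subset S by rewrite (sub_normal_Hall hS) ?normal_sub.
have tiRP : R :&: P = 1 by apply/trivgP; rewrite -tiSP setSI.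
have oRP : #|R * P| = (#|R| * #|P|)%N by rewrite TI_cardMg.
have r1 := prime_gt1 prR.
(* RP lies between P and N, so it is nonnormal; being larger than P, it is conjugate to N. *)
have mulRP : R * P = N.
  have e : R <*> P = R * P by rewrite norm_joinEr // (subset_trans sPG (normal_norm nR)).
  have sRPN : R <*> P \subset N by rewrite join_subG sRN.
  have [] := two_classes_overgroup tc (joing_subr R P) (subset_trans sRPN sNG).
  - move/(congr1 (fun X : {group gT} => #|X|)); rewrite /= e oRP => /eqP.
    by rewrite -{2}[#|P|]mul1n eqn_pmul2r // gtn_eqF.
  - by move/conj_card_eq/(_ sRPN)/(congr1 val) => /= <-.
  by move/negP: (Sylow_normalizer_nonnormal sylP nP (joing_subr R P) sRPN).
have oN : #|N| = (#|R| * #|P|)%N by rewrite -mulRP.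
have SIN : S :&: N = R.
  apply/esym/eqP; rewrite eqEcard subsetI sRS sRN /=.
  have : #|(S :&: N) * P| <= #|N| by rewrite subset_leq_card // mul_subG ?subsetIr.
  rewrite TI_cardMg ?oN ?leq_pmul2r //.
  by apply/trivgP; rewrite -tiSP setSI ?subsetIl.
have cRP : P \subset 'C(R).
  rewrite centsC; apply/commG1P/trivgP; rewrite -tiRP commg_subI // subsetI subxx /=.
    by apply: subset_trans sRN (subsetIr _ _).
  by apply: subset_trans sPG (normal_norm nR).
have cSP : 'C_S(P) = R.
  apply/eqP; rewrite eqEsubset subsetI sRS centsC cRP !andbT -SIN subsetI subsetIl /=.
  rewrite subsetI (subset_trans (subsetIl _ _) sSG) /=.
  by apply: subset_trans (subsetIr _ _) (cent_sub _).
(* BN properly contains N, so it is normal and equals G by the Frattini argument; intersecting with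
   S gives BR = S by the modular law. *)
have cover B : B \subset S -> ~~ (B \subset R) -> B * R = S.
  move=> sB nB; have nBG := Snormal B sB.
  have eBN : B <*> N = B * N by rewrite norm_joinEr // (subset_trans sNG (normal_norm nBG)).
  have sBN : B <*> N \subset G by rewrite join_subG normal_sub.
  have nsub : ~~ (B <*> N \subset N).
    by rewrite join_subG subxx andbT; apply: contra nB => sBN'; rewrite -SIN subsetI sB.
  have nBN : B <*> N <| G.
    have [] := two_classes_overgroup tc (subset_trans sPN (joing_subr B N)) sBN.
    - by move/(congr1 val) => /= e; rewrite e sPN in nsub.
    - rewrite conjs_sym => /conj_card_eq/(_ (joing_subr B N)) e.
      by move/(congr1 val): e => /= e; rewrite -e subxx in nsub.
    by [].
  have eG : B * N = G.
    rewrite -eBN -[RHS](normal_Sylow_mulN sylP nBN (subset_trans sPN (joing_subr B N))).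
    by rewrite -[RHS]/(gval (B <*> N) * gval N) mulGSid ?joing_subr.
  by rewrite -SIN setIC group_modl // eG; apply/setIidPr.
(* S is the product of a normal cyclic subgroup and R; either R lies in the former or the two
   commute. *)
have abS : abelian S.
  have [s Ss nRs] : exists2 s, s \in S & s \notin R.
    apply/subsetPn; apply: contra nP => sSR; rewrite /normal sPG.
    have : G \subset N by rewrite -{1}mulSP mul_subG // (subset_trans sSR).
    by rewrite subsetI => /andP[].
  have sRs : <[s]> \subset S by rewrite cycle_subG.
  have nsR : ~~ (<[s]> \subset R) by rewrite cycle_subG.
  have mS := cover _ sRs nsR.
  have abs : abelian <[s]> by apply: cycle_abelian.
  have [sR|ti] := prime_subgroupVti <[s]>%G prR.
    by rewrite -mS mulGSid.
  have cR : R \subset 'C(<[s]>).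
    by apply: (commuting_normals (Snormal _ sRs) nR).
  by rewrite -mS abelianM abs (cyclic_abelian (prime_cyclic prR)).
have sPNS : P \subset 'N(S) by apply: subset_trans sPG (normal_norm nS).
have coSP : coprime #|S| #|P| by rewrite coprime_sym; apply: pnat_coprime pP p'S.
pose A := [~: S, P]%G.
have tiAR : A :&: R = 1.
  rewrite -(coprime_abel_cent_TI sPNS coSP abS) -cSP /= setIA.
  by rewrite [[~: S, P] :&: S](setIidPl _) // commg_subl.
have sAS : A \subset S by rewrite commg_subl.
have ntA : A :!=: 1.
  apply/eqP=> /commG1P cS; have : S \subset R by rewrite -cSP subsetI subxx.
  move=> sSR; case/negP: nP; rewrite /normal sPG -{1}mulSP mul_subG ?normG //.
  by apply: subset_trans cS (cent_sub _).
have nsubR B : B \subset A -> B :!=: 1 -> ~~ (B \subset R).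
  by move=> sB ntB; apply: contra ntB => sBR; rewrite -subG1 -tiAR subsetI sB.
(* All nontrivial subgroups of A complement R in S, so they have the same order, which must be
   prime. *)
have oS B : B \subset A -> B :!=: 1 -> #|S| = (#|B| * #|R|)%N.
  move=> sB ntB; rewrite -(cover B) ?nsubR ?(subset_trans sB) // TI_cardMg //.
  by apply/trivgP; rewrite -tiAR setSI.
have prA : prime #|A|.
  have [//|[q prq dq]] := trivgVpdiv A; first by move/eqP: ntA.
  have [a Aa oa] := Cauchy prq dq.
  have sa : <[a]> \subset A by rewrite cycle_subG.
  have nta : <[a]> != 1 by rewrite -cardG_gt1 -orderE oa prime_gt1.
  have := oS _ sa nta; rewrite (oS A) // => /eqP; rewrite eqn_pmul2r // => /eqP->.
  by rewrite -orderE oa.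
have nA : A <| G by apply: Snormal.
(* If the orders agreed, the diagonal subgroup generated by a u would be normal. Either it equals A,
   which puts u in A, or its commutator with P is trivial, which puts a in R. *)
have neq : #|A| != #|R|.
  apply/eqP=> eAR.
  have /cyclicP[a eA] := prime_cyclic prA; have /cyclicP[u eR] := prime_cyclic prR.
  have Aa : a \in A by rewrite eA cycle_id.
  have Ru : u \in R by rewrite eR cycle_id.
  have oa : #[a] = #|R| by rewrite orderE -eA.
  have ou : #[u] = #|R| by rewrite orderE -eR.
  have Sa := subsetP sAS a Aa; have Su := subsetP sRS u Ru.
  have sB : <[a * u]> \subset S by rewrite cycle_subG groupM.
  have nB := Snormal _ sB.
  have com : commute a u by apply: (centsP abS).
  have oB : #|<[a * u]>| %| #|R|.
    by rewrite -orderE order_dvdn expgMn // -{1}oa -ou !expg_order mulg1.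
  have [sAB|ti] := prime_subgroupVti <[a * u]>%G prA.
    have eB : <[a * u]> = A :> {set gT}.
      by apply/esym/eqP; rewrite eqEcard sAB eAR dvdn_leq.
    have : u \in A by rewrite -(groupMl _ Aa) -eB cycle_id.
    move=> Au; have : u \in A :&: R by rewrite inE Au.
    by rewrite tiAR => /set1gP u1; move: r1; rewrite -ou u1 order1.
  have cB : <[a * u]> \subset 'C(P).
    apply/commG1P/trivgP; rewrite -ti subsetI commg_subl commSg //.
    by rewrite (subset_trans sPG (normal_norm nB)).
  have : a * u \in R by rewrite -cSP inE groupM //= -cycle_subG.
  rewrite groupMr // => Ra; have : a \in A :&: R by rewrite inE Aa.
  by rewrite tiAR => /set1gP a1; move: r1; rewrite -oa a1 order1.
have mulAP : A <*> P = A * P by rewrite norm_joinEr // (subset_trans sPG (normal_norm nA)).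
pose X := (A <*> P)%G.
have sXG : X \subset G by rewrite join_subG normal_sub.
have sPX : P \subset X := joing_subr A P.
have sAX : A \subset X := joing_subl A P.
have p'A : p^'.-group A := pgroupS sAS p'S.
have coAP : coprime #|A| #|P| := coprime_dvdl (cardSg sAS) coSP.
have oX : #|X| = (#|A| * #|P|)%N by rewrite /= mulAP TI_cardMg // coprime_TIg.
have nXP : ~~ (X \subset P).
  by apply/negP=> /subset_leq_card; rewrite oX -{2}[#|P|]mul1n leq_pmul2r // leqNgt prime_gt1.
have nX : X <| G.
  have [] := two_classes_overgroup tc sPX sXG => //.
    by move/(congr1 val) => /= e; rewrite /= e subxx in nXP.
  move/conjs_card/eqP; rewrite oX oN eqn_pmul2r //; exact: contraLR.
have nRX : ~~ (R \subset X).
  apply/negP=> /cardSg; rewrite oX Euclid_dvdM // dvdn_prime2 // eq_sym (negPf neq) /=.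
  by apply/negP; rewrite -prime_coprime // coprime_sym (pnat_coprime pP).
have nNX : nconj G N X = 0.
  by apply: nconj_normal0 => //; apply: contra nRX; apply: subset_trans.
have nonP : 0 < nonperm G P := Sylow_nonperm_gt0 sylP nP.
have minP C : C \subset P -> C :!=: P -> nonperm G C = 0.
  by move=> sC nC; apply: normal_nonperm; apply: maxP.
have dX : defect G X = (#|orbit 'JG X P| * nonperm G P)%N.
  by rewrite (defect_two_classes tc sXG) nNX mul0n addn0 (nconj_Sylow sylP).
have nPX : ~~ (P <| X).
  apply: contra nP => nPX; rewrite /normal sPG /=.
  have sylPX : p.-Sylow(X) P := pHall_subl sPX sXG sylP.
  apply: normal_norm; apply: char_normal_trans nX.
  by rewrite -(normal_Hall_pcore sylPX nPX) pcore_char.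
have [oXP cntX] : #|orbit 'JG X P| = #|A| /\ (#|subgroups X| + 1 = 2 * #|subgroups P| + #|A|)%N.
  apply: (card_subgroups_split (p := p)) => //.
  - exact: normalS nA.
  - by rewrite -p'natE.
  move=> B sB nB; apply: (normalS (subset_trans sB sPX) sXG); exact: maxP.
have ratio : (#|A| * #|subgroups P| = #|subgroups X|)%N.
  have dX0 : 0 < defect G X by rewrite dX oXP muln_gt0 cardG_gt0.
  have := class_C_ratio cC sPG sXG nonP minP dX0.
  rewrite dX oXP mulnAC mulnC => /eqP; rewrite eqn_pmul2l // => /eqP //.
have [o3 l2] : #|A| = 3 /\ #|subgroups P| = 2.
  by apply: split_count; [exact: prime_gt1 | exact: subgroups_ge2 | rewrite ratio].
have p2 : p = 2 by apply: (Syl3_mod prp (pHall_subl sPX sXG sylP)); rewrite oXP.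
have oP : #|P| = 2.
  have := card_subgroups_cyclic_pgroup pP cycP; rewrite l2 => -[].
  by rewrite {2}(card_pgroup pP) p2 => <-.
have tiXR : X :&: R = 1.
  by rewrite setIC; apply: prime_TIg.
exists X, R; split=> //.
- rewrite dprodE ?tiXR //; last by apply: commuting_normals nX nR tiXR.
  rewrite /= mulAP -mulgA (normC (subset_trans cRP (cent_sub R))) mulgA.
  by rewrite cover ?nsubR.
- by rewrite oX o3 oP.
- by apply: contra nPX => abX; rewrite -sub_abelian_normal.
(* The prime |R| is not 2, as R is a p'-group with p = 2, and not 3, which is |A|. *)
have : #|R| != 2 by apply: contraTneq p'R => e; rewrite /pgroup e p2.
rewrite eq_sym o3 in neq.
by case: #|R| prR neq => [|[|[|[|[|n]]]]].
Qed.

End NormalizerBigger.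

(** * Self-normalizing Sylow subgroups below the second class *)

Section SelfNormalizing.

Variable gT : finGroupType.
Implicit Types A B C D F G H K L M N P Q R S T X Y Z : {group gT}.

Lemma normal_over_Sylow p G P Y : p.-Sylow(G) P -> 'N_G(P) = P -> Y <| G -> P \subset Y -> Y :=: G.
Proof.
move=> sylP NP nY sPY; have := normal_Sylow_mulN sylP nY sPY.
by rewrite NP mulGSid.
Qed.

Lemma nontrivial_nonnormal G P : ~~ (P <| G) -> P :!=: 1.
Proof. by apply: contra => /eqP->; apply: normal1. Qed.

(** A larger overgroup of P is normal, hence G by the Frattini argument: P is a maximal subgroup. *)
Lemma over_self_normalizing p G P L Y : p.-Sylow(G) P -> 'N_G(P) = P -> two_classes G P L ->
  (forall B, B \in orbit 'JG G L -> ~~ (P \subset B)) ->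
  P \subset Y -> Y \subset G -> Y = P \/ Y = G.
Proof.
move=> sylP NP tc nL sPY sYG.
have [->|cY|nY] := two_classes_overgroup tc sPY sYG; [by left| |right].
  by have := nL _ cY; rewrite sPY.
by apply/val_inj/(normal_over_Sylow sylP NP nY sPY).
Qed.

(** Writing x = l k^x with l and k in L and cancelling gives x = k l, an element of L. *)
Lemma conj_product_neq G L x : L \subset G -> x \in G -> L :^ x != L -> L * (L :^ x) != G.
Proof.
move=> sLG Gx; apply: contra => /eqP e; have : x \in L * (L :^ x) by rewrite e.
case/mulsgP=> l _ Ll /imsetP[k Lk ->] ex.
suff Lx : x \in L by rewrite conjGid.
have : l * x^-1 * k = 1 by apply: (mulIg x); rewrite mul1g [RHS]ex conjgE !mulgA.
move/(canRL (mulgK k)); rewrite mul1g => /(canRL (mulKg l)) e1.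
by rewrite -groupV e1 groupM ?groupV.
Qed.

Variables (p : nat) (G P L : {group gT}).
Hypotheses (prp : prime p) (sylP : p.-Sylow(G) P) (nP : ~~ (P <| G)).
Hypotheses (NP : 'N_G(P) = P) (tc : two_classes G P L) (cC : in_class_C G).

Let sPG : P \subset G := pHall_sub sylP.
Let pP : p.-group P := pHall_pgroup sylP.

Lemma p'_normal B : B \subset G -> p^'.-group B -> B \notin orbit 'JG G L -> B <| G.
Proof.
move=> sB p'B; apply: (two_classes_normal tc) => //; apply/negP=> /conjs_card e.
have [_ dv _] := pgroup_pdiv pP (nontrivial_nonnormal nP).
by move: p'B; rewrite /pgroup e p'natE // dv.
Qed.

(** L = TP with T of prime order r >= 3, so |L(L)| = 2 l + r - 1 <= r l for l = |L(P)|. The class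
    condition (r np(P) + np(L)) l = np(P) |L(L)| then contradicts np(L) > 0. *)
Lemma self_normalizing_not_over :
  (forall B, B \subset P -> B :!=: P -> B <| G) -> P \subset L -> False.
Proof.
move=> maxP sPL.
have [sLG nL] := two_classes_sub (two_classes_sym tc).
have nLP : L \notin orbit 'JG G P by case: tc.
have ntP := nontrivial_nonnormal nP.
have [_ dvp _] := pgroup_pdiv pP ntP.
have p'norm B : B \subset G -> p^'.-group B -> B <| G.
  move=> sB p'B; apply: p'_normal => //; apply/negP=> /conjs_card e.
  by move: p'B; rewrite /pgroup e p'natE // (dvdn_trans dvp) ?cardSg.
have [S [nS hS mulSP tiSP]] : exists S, [/\ S <| G, p^'.-Hall(G) S, S * P = G & S :&: P = 1].
  apply: (normal_Sylows_Hall prp sylP) => q Q prq neq sylQ.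
  by apply: p'norm (pHall_sub sylQ) _; apply: pi_pgroup (pHall_pgroup sylQ) _.
have p'S := pHall_pgroup hS.
pose T := (L :&: S)%G.
have sTL : T \subset L by apply: subsetIl.
have sTS : T \subset S by apply: subsetIr.
have mulTP : T * P = L by rewrite /= group_modr // mulSP; apply/setIidPl.
have tiTP : T :&: P = 1 by apply/trivgP; rewrite -tiSP setSI.
have p'T : p^'.-group T := pgroupS sTS p'S.
have normT B : B \subset T -> B <| G.
  by move=> sB; apply: p'norm (pgroupS sB p'T); apply: subset_trans sLG; apply: subset_trans sTL.
have ntT : T :!=: 1.
  apply: contra nLP => /eqP T1; have -> : L = P by apply/val_inj; rewrite /= -mulTP T1 mul1g.
  exact: orbit_refl.
have oL : #|L| = (#|T| * #|P|)%N by rewrite -mulTP TI_cardMg.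
(* For t of prime order in T, the group generated by t and P is neither P nor normal, so it has the
   order of L, and t has the order of T. *)
have prT : prime #|T|.
  have [/eqP|[r prr dr]] := trivgVpdiv T; first by rewrite (negPf ntT).
  have [t Tt ot] := Cauchy prr dr.
  have st : <[t]> \subset T by rewrite cycle_subG.
  have nt := normT <[t]>%G st.
  have etP : <[t]> <*> P = <[t]> * P by rewrite norm_joinEr // (subset_trans sPG (normal_norm nt)).
  have otP : #|<[t]> * P| = (r * #|P|)%N.
    by rewrite TI_cardMg -?orderE ?ot //; apply/trivgP; rewrite -tiTP setSI.
  have sJ : <[t]> <*> P \subset L by rewrite join_subG sPL (subset_trans st).
  have sJG := subset_trans sJ sLG.
  have [] := two_classes_overgroup tc (joing_subr <[t]> P) sJG.
  - move/(congr1 (fun X : {group gT} => #|X|)); rewrite /= etP otP => /eqP.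
    by rewrite -{2}[#|P|]mul1n eqn_pmul2r // gtn_eqF ?prime_gt1.
  - by move/conjs_card/eqP; rewrite /= etP otP oL eqn_pmul2r // => /eqP <-.
  move=> nJ; have := normal_over_Sylow sylP NP nJ (joing_subr _ _) => /= e.
  by case/negP: nL; rewrite (_ : L = G) ?normal_refl //; apply/val_inj/eqP;
    rewrite /= eqEsubset sLG -e.
have NLP : 'N_L(P) = P.
  apply/eqP; rewrite eqEsubset subsetI sPL normG !andbT.
  by have := setSI 'N(P) sLG; rewrite NP.
have nPL : ~~ (P <| L).
  apply: contra ntT => nPL; have := NLP; rewrite (setIidPl (normal_norm nPL)) => e.
  by rewrite -subG1 -tiTP subsetI subxx -e.
have cycP : cyclic P := cyclic_of_proper_normal sPG nP maxP.
have sylPL : p.-Sylow(L) P := pHall_subl sPL sLG sylP.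
have [oLP cnt] : #|orbit 'JG L P| = #|T| /\ (#|subgroups L| + 1 = 2 * #|subgroups P| + #|T|)%N.
  apply: (card_subgroups_split (p := p)) => //.
  - exact: normalS (normT T (subxx _)).
  - by rewrite -p'natE.
  by move=> B sB nB; apply: (normalS (subset_trans sB sPL) sLG); apply: maxP.
have nonP : 0 < nonperm G P := Sylow_nonperm_gt0 sylP nP.
(* If L permuted with another conjugate, the product would properly contain L, so it would be normal
   and equal to G. *)
have nonL : 0 < nonperm G L.
  have [x Gx nx] := conjs_neq sLG nL.
  have sLx : L :^ x \subset G by rewrite -(conjGid Gx) conjSg.
  apply: (nonperm_gt0 (C := (L :^ x)%G)) => //; apply/negP=> /eqP com.
  have eJ := comm_joingE com.
  have sJ : L <*> (L :^ x)%G \subset G by rewrite join_subG sLG.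
  have [] := two_classes_overgroup tc (subset_trans sPL (joing_subl _ _)) sJ.
  - move=> e; case/negP: nLP; have -> : L = P; last exact: orbit_refl.
    by apply/val_inj/eqP; rewrite /= eqEsubset sPL andbT -(congr1 val e) joing_subl.
  - rewrite conjs_sym => /conj_card_eq/(_ (joing_subl _ _))/(congr1 val)/= e.
    case/negP: nx; rewrite eqEcard cardJg leqnn andbT {2}e.
    exact: joing_subr.
  move=> nJ; have := normal_over_Sylow sylP NP nJ (subset_trans sPL (joing_subl _ _)).
  by rewrite /= eJ => /eqP; apply/negP; apply: conj_product_neq.
have minP C : C \subset P -> C :!=: P -> nonperm G C = 0.
  by move=> sC nC; apply: normal_nonperm; apply: maxP.
have dL : defect G L = (#|T| * nonperm G P + nonperm G L)%N.
  by rewrite (defect_two_classes tc sLG) (nconj_Sylow sylP) // oLP nconj_id mul1n.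
have dL0 : 0 < defect G L by rewrite dL addn_gt0 nonL orbT.
have := class_C_ratio cC sPG sLG nonP minP dL0; rewrite dL.
(* L has |T| Sylow p-subgroups, a number that is 1 modulo p and hence not 2. *)
have r3 : 3 <= #|T|.
  have := card_Syl_mod L prp; rewrite (card_Syl sylPL) -card_conjs oLP.
  case: #|T| (prime_gt1 prT) => [|[|[|n]]] // _.
  by case: p prp => [|[|[|q]]] //; rewrite modn_small.
have l2 := subgroups_ge2 ntP.
move: cnt r3 l2 nonP nonL; clear.
move: #|subgroups L| #|subgroups P| #|T| (nonperm G P) (nonperm G L) => x l r a b.
move=> ex r3 l2 a0 b0 e; have hx : x <= r * l by nia.
have : a * x <= a * (r * l) by rewrite leq_mul2l hx orbT.
have : 0 < b * l by rewrite muln_gt0 b0 ltnW.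
rewrite -e; lia.
Qed.

End SelfNormalizing.

(** * Self-normalizing Sylow subgroups that are maximal *)

Section MaximalSylow.

Variable gT : finGroupType.
Implicit Types A B C D F G H K L M N P Q R S T X Y Z : {group gT}.

Lemma card_conjs_gt1 G H : H \subset G -> ~~ (H <| G) -> 1 < #|orbit 'JG G H|.
Proof.
move=> sHG nH; rewrite card_conjs indexg_gt1; apply: contra nH => sGN.
by rewrite /normal sHG; apply: subset_trans sGN (subsetIr _ _).
Qed.

Lemma Sylow_not_in_conj (p q : nat) G P L : p.-Sylow(G) P -> P :!=: 1 -> q.-group L -> q != p ->
  forall B, B \in orbit 'JG G L -> ~~ (P \subset B).
Proof.
move=> sylP ntP qL neq B cB; have pP := pHall_pgroup sylP.
have [prp dvp _] := pgroup_pdiv pP ntP.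
apply/negP=> /cardSg; rewrite (conjs_card cB) => /(dvdn_trans dvp) dL.
have := pgroupP qL _ prp dL; rewrite inE /= => /eqP e.
by rewrite e eqxx in neq.
Qed.

(** P is maximal, so M lies in P or MP = G. In the latter case G / M is a p-group, so the q-group L
    lies in M and M = G. *)
Lemma normal_in_self_normalizing (p q : nat) G P L M : p.-Sylow(G) P -> ~~ (P <| G) ->
  'N_G(P) = P ->
  two_classes G P L -> q.-Sylow(G) L -> 'N_G(L) = L -> q != p -> M <| G -> M :!=: G -> M \subset P.
Proof.
move=> sylP nP NP tc sylL NL neq nM nMG; have qL := pHall_pgroup sylL.
have ntP := nontrivial_nonnormal nP; have pP := pHall_pgroup sylP; have sPG := pHall_sub sylP.
have [sLG nL] := two_classes_sub (two_classes_sym tc).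
have nPL := Sylow_not_in_conj sylP ntP qL neq.
have sMPG : M <*> P \subset G by rewrite join_subG normal_sub.
have [e|e] := over_self_normalizing sylP NP tc nPL (joing_subr M P) sMPG.
  by rewrite -(congr1 val e) joing_subl.
have sPN : P \subset 'N(M) := subset_trans sPG (normal_norm nM).
have sLM : L \subset M.
  have sLN : L \subset 'N(M) := subset_trans sLG (normal_norm nM).
  rewrite -quotient_sub1 //.
  have sLP : L / M \subset P / M.
    rewrite -(quotientMidl M P) -norm_joinEr //.
    by apply: quotientS; rewrite (congr1 val e : M <*> P = G).
  have : (L / M) :&: (P / M) = 1.
    apply: coprime_TIg; apply: (@pnat_coprime q); first exact: quotient_pgroup.
    by apply: quotient_pgroup; apply: pi_p'group pP _.
  by rewrite (setIidPl sLP) => ->.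
by rewrite (normal_over_Sylow sylL NL nM sLM) eqxx in nMG.
Qed.

(* Here G has no proper nontrivial normal subgroup, so that |L(G)| = 2 + h + k
   where h, k > 1 are the class sizes, whereas class C gives |L(G)| = 2 (h + k). *)
Lemma two_nonnormal_Sylows (p q : nat) G P L : p.-Sylow(G) P -> q.-Sylow(G) L -> q != p ->
  two_classes G P L -> 'N_G(P) = P -> in_class_C G -> False.
Proof.
move=> sylP sylL neq tc NP cC; have tc' := two_classes_sym tc.
have [sPG nP] := two_classes_sub tc; have [sLG nL] := two_classes_sub tc'.
have [pP qL] := (pHall_pgroup sylP, pHall_pgroup sylL).
have [ntP ntL] := (nontrivial_nonnormal nP, nontrivial_nonnormal nL).
have coPL : coprime #|P| #|L|.
  by apply: pnat_coprime pP _; apply: pi_p'group qL _; rewrite !inE eq_sym.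
have NL : 'N_G(L) = L.
  have [] := two_classes_overgroup tc' (_ : L \subset 'N_G(L)%G) (subsetIl _ _).
  - by rewrite subsetI sLG normG.
  - by move/(congr1 val).
  - move/conjs_card => /= oN.
    have [prq dvq _] := pgroup_pdiv qL ntL.
    have : q %| #|P| by rewrite -oN (dvdn_trans dvq) ?cardSg // subsetI sLG normG.
    by move/(pgroupP pP _ prq); rewrite inE /= (negPf neq).
  have sLN : L \subset 'N_G(L)%G by rewrite subsetI sLG normG.
  by move=> nN; have := Sylow_normalizer_nonnormal sylL nL sLN (subxx _); rewrite nN.
have trivN M : M <| G -> M :!=: G -> M :=: 1.
  move=> nM nMG; apply/trivgP; rewrite -(coprime_TIg coPL) subsetI.
  rewrite (normal_in_self_normalizing sylP nP NP tc sylL NL neq nM nMG).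
  by rewrite (normal_in_self_normalizing sylL nL NL tc' sylP NP _ nM nMG) // eq_sym.
have nonP := Sylow_nonperm_gt0 sylP nP; have nonL := Sylow_nonperm_gt0 sylL nL.
have properP B : B \subset P -> B :!=: P -> B :=: 1.
  move=> sB nB; have sBG := subset_trans sB sPG; apply: trivN.
    apply: (two_classes_normal tc) => //; apply/negP=> cB.
      by case/negP: nB; rewrite eqEcard sB (conjs_card cB) leqnn.
    have := coprime_dvdl (cardSg sB) coPL; rewrite (conjs_card cB) /coprime gcdnn => o1.
    by case/negP: ntL; rewrite trivg_card1.
  by apply: contra nB => /eqP e; rewrite eqEsubset sB e.
have properL B : B \subset L -> B :!=: L -> B :=: 1.
  move=> sB nB; have sBG := subset_trans sB sLG; apply: trivN.
    apply: (two_classes_normal tc) => //; apply/negP=> cB.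
      have := coprime_dvdr (cardSg sB) coPL; rewrite (conjs_card cB) /coprime gcdnn => o1.
      by case/negP: ntP; rewrite trivg_card1.
    by case/negP: nB; rewrite eqEcard sB (conjs_card cB) leqnn.
  by apply: contra nB => /eqP e; rewrite eqEsubset sB e.
have two B : B :!=: 1 -> (forall C, C \subset B -> C :!=: B -> C :=: 1) -> #|subgroups B| = 2.
  move=> ntB prB; have -> : 2 = #|[set 1%G; B]| by rewrite cards2 -val_eqE /= eq_sym ntB.
  apply: eq_card => C; rewrite in_set2 mem_subgroups.
  apply/idP/orP=> [sC|[]/eqP->]; rewrite ?sub1G //.
  have [|nC] := eqVneq C B; [by right | left].
  by apply/eqP/val_inj; apply: prB; rewrite // -val_eqE in nC.
have np0 B C : (forall D, D \subset B -> D :!=: B -> D :=: 1) -> C \subset B -> C :!=: B ->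
  nonperm G C = 0.
  by move=> prB sC nC; rewrite normal_nonperm // (prB C) ?normal1.
have defL : defect G L = nonperm G L by apply: defect_minimal => C; apply: np0.
have defG := defect_two_classes tc (subxx G).
rewrite !(nconj_normal (normal_refl G)) // in defG.
(* P and L have two subgroups each, so the class condition equates their [nonperm]. *)
have eqPL : nonperm G L = nonperm G P.
  have := class_C_ratio cC sPG sLG nonP (fun C => np0 P C properP); rewrite defL => /(_ nonL)/eqP.
  by rewrite !two // eqn_pmul2r // => /eqP.
have h2 := card_conjs_gt1 sPG nP; have k2 := card_conjs_gt1 sLG nL.
have dG0 : 0 < defect G G by rewrite defG addn_gt0 muln_gt0 nonP ltnW.
have := class_C_ratio cC sPG (subxx G) nonP (fun C => np0 P C properP) dG0.
rewrite defG eqPL two // -mulnDl [RHS]mulnC mulnAC => /eqP; rewrite eqn_pmul2r // => /eqP cG.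
have : #|subgroups G| <= 2 + (#|orbit 'JG G P| + #|orbit 'JG G L|).
  have sU : subgroups G \subset [set 1%G; G] :|: (orbit 'JG G P :|: orbit 'JG G L).
    apply/subsetP=> B; rewrite mem_subgroups !in_setU => sB; rewrite -!orbA.
    have [->|nBG] := eqVneq B G; first by rewrite !inE eqxx orbT.
    have [nB|nB] := boolP (B <| G).
      by rewrite in_set1 -val_eqE /= (trivN B) ?eqxx.
    by have [_ _ _ cov] := tc; have := cov B; rewrite nonnormalP sB nB => /(_ isT) ->;
      rewrite !orbT.
  apply: leq_trans (subset_leq_card sU) _; apply: leq_trans (leq_card_setU _ _) _.
  apply: leq_add; first by rewrite cards2; case: (_ == _).
  exact: leq_card_setU.
rewrite -cG; move: h2 k2; clear; move: #|_| #|_| => h k; lia.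
Qed.

Variables (p : nat) (G P L : {group gT}).
Hypotheses (prp : prime p) (sylP : p.-Sylow(G) P) (nP : ~~ (P <| G)).
Hypotheses (NP : 'N_G(P) = P) (tc : two_classes G P L) (cC : in_class_C G).
Hypothesis nPL : forall B, B \in orbit 'JG G L -> ~~ (P \subset B).

Let sPG : P \subset G := pHall_sub sylP.
Let pP : p.-group P := pHall_pgroup sylP.
Let over Y : P \subset Y -> Y \subset G -> Y = P \/ Y = G :=
  @over_self_normalizing _ p G P L Y sylP NP tc nPL.

(** TP contains the maximal subgroup P, so it is P or G; comparing orders identifies T. *)
Lemma complement_simple S T : S * P = G -> S :&: P = 1 -> T \subset S -> T <| G ->
  T = 1%G \/ T = S.
Proof.
move=> mulSP tiSP sTS nT.
have e : T <*> P = T * P by rewrite norm_joinEr // (subset_trans sPG (normal_norm nT)).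
have sJ : T <*> P \subset G by rewrite join_subG normal_sub.
have tiTP : T :&: P = 1 by apply/trivgP; rewrite -tiSP setSI.
have [/(congr1 val)|/(congr1 val)] := over (joing_subr T P) sJ; rewrite /= => eJ.
  left; apply/val_inj/trivgP; rewrite -tiTP subsetI subxx /= -eJ; exact: joing_subl.
right; apply/val_inj/eqP; rewrite /= eqEcard sTS -(leq_pmul2r (cardG_gt0 P)).
by rewrite -(TI_cardMg tiSP) -(TI_cardMg tiTP) mulSP -e eJ leqnn.
Qed.

(* Every proper nontrivial subgroup of the normal complement S is conjugate to L;
   comparing L with S gives exactly two of them, too few for a noncyclic S. *)
Lemma self_normalizing_p' : p^'.-group L -> False.
Proof.
move=> p'L; have tc' := two_classes_sym tc; have [sLG nL] := two_classes_sub tc'.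
have ntP := nontrivial_nonnormal nP; have ntL := nontrivial_nonnormal nL.
have [S [nS hS mulSP tiSP]] : exists S, [/\ S <| G, p^'.-Hall(G) S, S * P = G & S :&: P = 1].
  apply: (normal_Sylows_Hall prp sylP) => q Q prq neq sylQ.
  apply: (p'_normal prp sylP nP tc (pHall_sub sylQ)); first
    by apply: pi_pgroup (pHall_pgroup sylQ) _.
  (* If Q were conjugate to L, both classes would consist of Sylow subgroups, which is already
     excluded. *)
  apply/negP=> /conjsP[x Gx eQ]; apply: (two_nonnormal_Sylows sylP _ neq tc NP cC).
  by move: sylQ; rewrite eQ /= pHallJ.
have sSG := normal_sub nS; have p'S := pHall_pgroup hS.
have sLS : L \subset S by rewrite (sub_normal_Hall hS nS sLG).
have dich B : B \subset S -> B != 1%G -> B != S -> B \in orbit 'JG G L.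
  move=> sB ntB nBS; apply: contraTT isT => cB.
  have nB := p'_normal prp sylP nP tc (subset_trans sB sSG) (pgroupS sB p'S) cB.
  have [e|e] := complement_simple mulSP tiSP sB nB; first by rewrite e eqxx in ntB.
  by rewrite e eqxx in nBS.
have LnS : L != S by apply: contra nL => /eqP->.
have min C : C \subset L -> C :!=: L -> nonperm G C = 0.
  move=> sC nC; case: (eqVneq C 1%G) => [->|ntC]; first by rewrite normal_nonperm ?normal1.
  have cCL : C \in orbit 'JG G L.
    apply: dich ntC _; first exact: subset_trans sLS.
    by apply: contra nC => /eqP e; rewrite eqEsubset sC e.
  by case/negP: nC; rewrite (conj_card_eq cCL sC).
have nonL : 0 < nonperm G L.
  apply: (nonperm_gt0 sPG); apply/negP=> /eqP com; have e := comm_joingE com.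
  have sJ : L <*> P \subset G by rewrite join_subG sLG.
  have tiLP : L :&: P = 1 by apply/trivgP; rewrite -tiSP setSI.
  have [/(congr1 val)|/(congr1 val)] := over (joing_subr L P) sJ; rewrite /= => eJ.
    case/negP: ntL; rewrite -subG1 -tiLP subsetI subxx /= -eJ; exact: joing_subl.
  case/negP: LnS; rewrite -val_eqE /= eqEcard sLS -(leq_pmul2r (cardG_gt0 P)).
  by rewrite -(TI_cardMg tiSP) -(TI_cardMg tiLP) mulSP -e eJ leqnn.
have dS : defect G S = (#|orbit 'JG G L| * nonperm G L)%N.
  rewrite (defect_two_classes tc sSG) (nconj_normal nS sLS) nconj_normal0 ?mul0n //.
  by apply: contra ntP => sPS; rewrite -subG1 -tiSP subsetI sPS subxx.
have kk := card_conjs_gt1 sLG nL.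
have dS0 : 0 < defect G S by rewrite dS muln_gt0 nonL ltnW.
have subL : subgroups L = [set 1%G; L].
  apply/setP=> C; rewrite mem_subgroups in_set2; apply/idP/orP=> [sC|[]/eqP->]; rewrite ?sub1G //.
  have [|ntC] := eqVneq C 1%G; [by left | right].
  apply: contraTT isT => nC; have cCL : C \in orbit 'JG G L.
    apply: dich ntC _; first exact: subset_trans sLS.
    by apply: contra nC => /eqP e; rewrite -val_eqE eqEsubset sC e.
  by rewrite (conj_card_eq cCL sC) eqxx in nC.
have cL : #|subgroups L| = 2 by rewrite subL cards2 -val_eqE /= eq_sym ntL.
have := class_C_ratio cC sLG sSG nonL min dS0.
rewrite dS cL mulnAC [RHS]mulnC => /eqP; rewrite eqn_pmul2r // => /eqP cS.
have subS : subgroups S = [set 1%G; S] :|: orbit 'JG G L.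
  apply/setP=> C; rewrite mem_subgroups in_setU in_set2; apply/idP/idP=> [sC|].
    have [|n1] := eqVneq C 1%G => //=; have [|nC] := eqVneq C S => //=; exact: dich.
  by case/orP=> [/orP[]/eqP->|cCL]; rewrite ?sub1G ?subxx // (conjs_subnormal nS cCL).
(* With k conjugates of L, the class condition gives |L(S)| = 2 k, and the list above gives k +
   2. *)
have k2 : #|orbit 'JG G L| = 2.
  have : [set 1%G; S] :&: orbit 'JG G L = set0.
    apply/setP=> C; rewrite in_setI in_set2 in_set0; apply/negP=> /andP[/orP[]/eqP-> cCL].
      by case/negP: nL; rewrite -(conjs_normal cCL) normal1.
    by case/negP: nL; rewrite -(conjs_normal cCL).
  have S1 : 1%G != S.
    by apply: contra ntL => /eqP e; rewrite -subG1 (subset_trans sLS) // -e.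
  move=> e; move: cS; rewrite subS cardsU e cards0 subn0 cards2 S1.
  by move: #|_|; clear => k; lia.
have /cards2P[A [B [nAB eO]]] : #|orbit 'JG G L| == 2 by rewrite k2.
have cA : A \in orbit 'JG G L by rewrite eO !inE eqxx.
have cB : B \in orbit 'JG G L by rewrite eO !inE eqxx orbT.
have oA := conjs_card cA; have oB := conjs_card cB.
(* A and B share the identity, so together they have fewer than 2 |L| <= |S| elements. An s outside
   both generates S, and L is then characteristic in a cyclic normal subgroup. *)
have [s Ss nsAB] : exists2 s, s \in S & s \notin A :|: B.
  apply/subsetPn; apply/negP=> /subset_leq_card; rewrite cardsU oA oB.
  have i1 : 0 < #|A :&: B| := cardG_gt0 _.
  have /dvdnP[m em] := cardSg sLS.
  have m2 : 1 < m.
    move: em; case: m => [|[|m]] // e; first by have := cardG_gt0 S; rewrite e.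
    by case/negP: LnS; rewrite -val_eqE /= eqEcard sLS e mul1n leqnn.
  have := leq_mul m2 (leqnn #|L|); rewrite -em.
  by move: i1 (cardG_gt0 L); clear; move: #|A :&: B| #|S| #|L| => x y z; lia.
have ss : <[s]> \subset S by rewrite cycle_subG.
have eS : S = <[s]>%G.
  apply/eqP; rewrite eq_sym; apply: contraNT nsAB => nsS; rewrite in_setU.
  have [s1|nts] := eqVneq <[s]>%G 1%G.
    by rewrite -!cycle_subG (congr1 val s1 : <[s]> = 1) sub1G.
  by have := dich _ ss nts nsS; rewrite eO in_set2 => /orP[]/eqP<-; rewrite cycle_id ?orbT.
case/negP: nL; apply: char_normal_trans nS; rewrite sub_cyclic_char // eS; exact: cycle_cyclic.
Qed.

End MaximalSylow.

(** * Nonnormal Sylow subgroups: the remaining cases *)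

Section NonnormalSylow.

Variable gT : finGroupType.
Implicit Types A B C D F G H K L M N P Q R S T X Y Z : {group gT}.

(** The normal complement S has prime order. If S lies in L, then L is the product of the normal
    subgroups S and P :&: L; otherwise L is a p-group, conjugate to a proper subgroup of P. Either
    way L is normal. *)
Lemma self_normalizing_mixed p G P L : prime p -> p.-Sylow(G) P -> ~~ (P <| G) -> 'N_G(P) = P ->
  two_classes G P L -> (forall B, B \subset P -> B :!=: P -> B <| G) ->
  (forall B, B \in orbit 'JG G L -> ~~ (P \subset B)) ->
  ~~ p^'.-group L -> False.
Proof.
move=> prp sylP nP NP tc maxP nPL p'L.
have sPG := pHall_sub sylP; have pP := pHall_pgroup sylP.
have [sLG nL] := two_classes_sub (two_classes_sym tc).
have p'norm B : B \subset G -> p^'.-group B -> B <| G.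
  move=> sB p'B; apply: (p'_normal prp sylP nP tc) => //; apply: contra p'L => cB.
  by rewrite /pgroup -(conjs_card cB).
have [S [nS hS mulSP tiSP]] : exists S, [/\ S <| G, p^'.-Hall(G) S, S * P = G & S :&: P = 1].
  apply: (normal_Sylows_Hall prp sylP) => q Q prq neq sylQ.
  by apply: p'norm (pHall_sub sylQ) _; apply: pi_pgroup (pHall_pgroup sylQ) _.
have sSG := normal_sub nS; have p'S := pHall_pgroup hS.
have ntS : S :!=: 1.
  apply: contra nP => /eqP S1; rewrite (_ : P = G) ?normal_refl //; apply/val_inj.
  by rewrite /= -mulSP S1 mul1g.
have prS : prime #|S|.
  have [/eqP|[r prr dr]] := trivgVpdiv S; first by rewrite (negPf ntS).
  have [s Ss os] := Cauchy prr dr; have ss : <[s]> \subset S by rewrite cycle_subG.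
  have ns : <[s]> <| G by apply: p'norm (pgroupS ss p'S); apply: subset_trans sSG.
  have [e|e] := complement_simple sylP NP tc nPL mulSP tiSP ss ns.
    by have := prime_gt1 prr; rewrite -os orderE (congr1 val e : <[s]> = 1) cards1.
  by rewrite -e -orderE os.
have [sSL|tiLS] := prime_subgroupVti L prS.
  have eL : S * (P :&: L) = L.
    by rewrite group_modl // mulSP; apply/setIidPr.
  have nI : (P :&: L)%G <| G.
    apply: maxP (subsetIl _ _) _; apply: contra (nPL _ (orbit_refl _ _ L)) => /eqP <-.
    exact: subsetIr.
  by case/negP: nL; rewrite -eL normalM.
have pL : p.-group L.
  have eLS : L <*> S = L * S by rewrite norm_joinEl // (subset_trans sLG (normal_norm nS)).
  apply: pnat_dvd pP; rewrite -(dvdn_pmul2r (cardG_gt0 S)) -TI_cardMg // -eLS.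
  by rewrite [(#|P| * _)%N]mulnC -(TI_cardMg tiSP) mulSP cardSg // join_subG sLG.
have [x Gx sLP] := Sylow_subJ sylP sLG pL.
have cB : (L :^ x^-1)%G \in orbit 'JG G L by apply/conjsP; exists x^-1; rewrite ?groupV.
case/negP: nL; rewrite -(conjs_normal cB); apply: maxP; first by rewrite /= sub_conjgV.
by apply: contra (nPL _ cB) => /eqP <-.
Qed.

Section SubgroupOfSylow.

Variables (p : nat) (G P L : {group gT}).
Hypotheses (prp : prime p) (sylP : p.-Sylow(G) P) (tc : two_classes G P L).
Hypotheses (cC : in_class_C G) (sLP : L \subset P).

(** Here G = SP with S normal of prime order, P is cyclic and L is its maximal subgroup. Counting in
    SL gives |S| = 3 and |L| = 2, so P has order 4 and its action on S has L in the kernel; but L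
    does not centralize S. *)
Lemma Sylow_over_class : False.
Proof.
have [sPG nP] := two_classes_sub tc; have [sLG nL] := two_classes_sub (two_classes_sym tc).
have pP := pHall_pgroup sylP; have pL : p.-group L := pgroupS sLP pP.
have nLP : L \notin orbit 'JG G P by case: tc.
have ntP := nontrivial_nonnormal nP; have ntL := nontrivial_nonnormal nL.
have neLP : L :!=: P.
  by apply: contra nLP => /eqP/val_inj->; apply: orbit_refl.
have ltLP : #|L| < #|P| by rewrite ltn_neqAle subset_leq_card // andbT;
  apply: contra neLP => /eqP e; rewrite eqEcard sLP e leqnn.
have nPL B : B \in orbit 'JG G L -> ~~ (P \subset B).
  by move=> cB; apply/negP=> /subset_leq_card; rewrite (conjs_card cB) leqNgt ltLP.
have NP : 'N_G(P) = P.
  have sPN : P \subset 'N_G(P)%G by rewrite subsetI sPG normG.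
  have [|/nPL|nN] := two_classes_overgroup tc sPN (subsetIl _ _); first by move/(congr1 val).
    by rewrite sPN.
  by have := Sylow_normalizer_nonnormal sylP nP sPN (subxx _); rewrite nN.
have pnormal B : B \subset G -> ~~ p.-group B -> B <| G.
  move=> sB npB; apply: (two_classes_normal tc) => //; apply: contra npB => cB.
    by rewrite /pgroup (conjs_card cB).
  by rewrite /pgroup (conjs_card cB).
have over := over_self_normalizing sylP NP tc nPL.
have [S [prS sSG p'S]] : exists S, [/\ prime #|S|, S \subset G & p^'.-group S].
  have : #|G : P| != 1%N.
    by rewrite indexg_eq1; apply: contra nP => sGP; rewrite (_ : P = G) ?normal_refl //;
      apply/val_inj/eqP; rewrite eqEsubset sPG.
  move/eqP=> i1; have [q prq dq] : exists2 q, prime q & q %| #|G : P|.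
    by exists (pdiv #|G : P|);
      rewrite ?pdiv_dvd // pdiv_prime // ltn_neqAle eq_sym indexg_gt0 andbT; apply/eqP.
  have neq : q != p.
    apply: contraTneq dq => ->; rewrite -p'natE //.
    by have /and3P[] := sylP.
  have dqG : q %| #|G| by rewrite -(Lagrange sPG) dvdn_mull.
  have [y Gy oy] := Cauchy prq dqG; exists <[y]>%G; split; rewrite ?cycle_subG -?orderE ?oy //.
  by rewrite /pgroup -orderE oy pnatE.
have tiSP : S :&: P = 1 by rewrite setIC; apply: coprime_TIg; apply: pnat_coprime pP p'S.
have np B : S \subset B -> ~~ p.-group B.
  move=> sSB; apply/negP=> /(pgroupS sSB) pS.
  by have := prime_gt1 prS; rewrite (pnat_1 pS p'S).
have nS : S <| G := pnormal S sSG (np S (subxx _)).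
have mulSP : S * P = G.
  have e : S <*> P = S * P by rewrite norm_joinEr // (subset_trans sPG (normal_norm nS)).
  have sJ : S <*> P \subset G by rewrite join_subG sSG.
  have [/(congr1 val)|/(congr1 val)] := over _ (joing_subr S P) sJ; rewrite /= e // => eJ.
  by have := np P; rewrite pP -{1}eJ mulG_subl => /(_ isT).
have cent B : B <| G -> B \subset P -> B \subset 'C(S).
  move=> nB sB; apply: commuting_normals nS nB _.
  by apply/trivgP; rewrite -tiSP setIS.
pose X := (S <*> L)%G.
have eX : S <*> L = S * L by rewrite norm_joinEr // (subset_trans sLG (normal_norm nS)).
have sLX : L \subset X := joing_subr S L.
have sSX : S \subset X := joing_subl S L.
have sXG : X \subset G by rewrite join_subG sSG.
have nX : X <| G := pnormal X sXG (np X sSX).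
have tiSL : S :&: L = 1 by apply/trivgP; rewrite -tiSP setIS.
have XP : X :&: P = L by rewrite /= eX setIC -group_modr // [P :&: S]setIC tiSP mul1g.
have sylLX : p.-Sylow(X) L.
  by have [] := coprime_mulGp_Hall (esym eX : S * L = X) p'S pL.
have nLX : ~~ (L <| X).
  apply: contra nL => nLX; apply: char_normal_trans nX.
  by rewrite -(normal_Hall_pcore sylLX nLX) pcore_char.
have ncL : ~~ (L \subset 'C(S)).
  apply: contra nLX => cLS; rewrite /normal sLX /= eX mul_subG ?normG //.
  by rewrite centsC in cLS; apply: subset_trans cLS (cent_sub _).
have properL B : B \subset L -> B :!=: L -> B <| G.
  move=> sB nB; apply: (two_classes_normal tc) => //; first exact: subset_trans sLG.
    apply/negP=> cB; have := subset_leq_card sB; rewrite (conjs_card cB) leqNgt ltLP //.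
  by apply: contra nB => cB; rewrite (conj_card_eq cB sB).
have cycL : cyclic L := cyclic_of_proper_normal sLG nL properL.
have conjL B : B \in orbit 'JG G L -> B \subset P -> B = L.
  move=> cB sB; apply: (conj_card_eq cB); rewrite -XP subsetI sB andbT.
  by rewrite (conjs_subnormal nX cB).
(* If P is not cyclic, each of its elements lies in L or generates a normal subgroup, which
   centralizes S; but P is not the union of two proper subgroups. *)
have cycP : cyclic P.
  apply: contraT => ncP.
  have ch x : x \in P -> (x \in 'C(S)) || (x \in L).
    move=> Px; have sx : <[x]> \subset P by rewrite cycle_subG.
    have [nx|nx] := boolP (<[x]> <| G).
      by rewrite -cycle_subG (cent <[x]>%G).
    have [_ _ _ cov] := tc; have := cov <[x]>%G; rewrite nonnormalP (subset_trans sx sPG) nx.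
    case/(_ isT)/orP=> cx.
      by case/negP: ncP; rewrite -(congr1 val (conj_card_eq cx sx)) cycle_cyclic.
    by rewrite -(conjL _ cx sx) cycle_id orbT.
  have [c Pc nc] : exists2 c, c \in P & c \notin L.
    by apply/subsetPn; apply: contra neLP => sPL; rewrite eqEsubset sLP.
  have Cc : c \in 'C(S) by have := ch c Pc; rewrite (negPf nc) orbF.
  have [l Ll nl] := subsetPn ncL; have Pl := subsetP sLP l Ll.
  have := ch (c * l) (groupM Pc Pl); rewrite groupMl // (negPf nl).
  by rewrite groupMr // (negPf nc).
have [F [sF oP maxF]] := cyclic_pgroup_max pP cycP ntP.
have sLF : L \subset F by rewrite maxF.
(* Were F different from L, it would be normal and centralize S, and so would L inside it. *)
have eF : F = L.
  apply/eqP; apply: contraT => nFL; case/negP: ncL; apply: subset_trans sLF _.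
  have nFP : F :!=: P by rewrite -maxF.
  apply: (fun n => cent F n sF); apply: (two_classes_normal tc); first exact: subset_trans sPG.
    by apply: contra nFP => cF; rewrite (conj_card_eq cF sF).
  by apply: contra nFL => cF; rewrite (conjL F cF sF).
rewrite eF in oP.
have [oXL cnt] : #|orbit 'JG X L| = #|S| /\ (#|subgroups X| + 1 = 2 * #|subgroups L| + #|S|)%N.
  apply: (card_subgroups_split (p := p)) => //.
  - exact: normalS nS.
  - by rewrite -p'natE.
  by move=> B sB nB; apply: (normalS (subset_trans sB sLX) sXG); apply: properL.
have nonL : 0 < nonperm G L.
  have [x Gx nx] := conjs_neq sLG nL.
  have sLx : L :^ x \subset X by rewrite -(normsP (normal_norm nX) x Gx) conjSg.
  apply: (nonperm_gt0 (C := (L :^ x)%G)); first exact: subset_trans sXG.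
  apply/negP=> /eqP com; case/negP: nx; rewrite eqEcard cardJg leqnn andbT.
  by apply: (pgroup_permuting_Sylow sylLX) com; rewrite ?pgroupJ.
have oGL : #|orbit 'JG G L| = #|S|.
  have sPN : P \subset 'N_G(L)%G.
    rewrite subsetI sPG; apply: sub_abelian_norm sLP; exact: cyclic_abelian.
  rewrite card_conjs; have [/(congr1 val)/= ->|/(congr1 val)/= e] := over _ sPN (subsetIl _ _).
    by rewrite -divgS // -{1}mulSP TI_cardMg // mulnK.
  by case/negP: nL; rewrite /normal sLG; move: (subsetIr G 'N(L)); rewrite e.
have dX : defect G X = (#|S| * nonperm G L)%N.
  rewrite (defect_two_classes tc sXG) (nconj_normal nX sLX) oGL nconj_normal0 ?mul0n //.
  by apply: contra neLP => sPX; rewrite -XP (setIidPr sPX).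
have minL C : C \subset L -> C :!=: L -> nonperm G C = 0.
  by move=> sC nC; apply: normal_nonperm; apply: properL.
have dX0 : 0 < defect G X by rewrite dX muln_gt0 cardG_gt0.
have ratio : (#|S| * #|subgroups L| = #|subgroups X|)%N.
  have := class_C_ratio cC sLG sXG nonL minL dX0.
  by rewrite dX mulnAC mulnC => /eqP; rewrite eqn_pmul2l // => /eqP.
have [o3 l2] : #|S| = 3 /\ #|subgroups L| = 2.
  by apply: split_count; [exact: prime_gt1 | exact: subgroups_ge2 | rewrite ratio].
have p2 : p = 2 by apply: (Syl3_mod prp sylLX); rewrite oXL.
have oL : #|L| = 2.
  have := card_subgroups_cyclic_pgroup pL cycL; rewrite l2 => -[].
  by rewrite {2}(card_pgroup pL) p2 => <-.
case/negP: ncL; rewrite centsC; apply/subsetP=> s Ss.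
have [->|nts] := eqVneq s 1; first exact: group1.
(* P permutes the two nonidentity elements of S, so the stabilizer of s has index at most 2 and
   contains the subgroup of order 2 of P. *)
have sub : s ^: P \subset S :\ 1.
  rewrite subsetD1; apply/andP; split; first
    by rewrite class_sub_norm // (subset_trans sPG (normal_norm nS)).
  apply/negP=> /imsetP[x _ /esym/eqP]; rewrite conjg_eq1; exact/negP.
have := subset_leq_card sub; rewrite -index_cent1.
have -> : #|S :\ 1| = 2 by have := cardsD1 1 S; rewrite o3 group1 => -[].
move=> le2; have sLC : L \subset 'C_P[s].
  rewrite -(cardSg_cyclic cycP sLP (subsetIl P 'C[s])) oL.
  have := Lagrange (subsetIl P 'C[s]); rewrite oP oL p2 /=.
  move: le2 (indexg_gt0 P 'C_P[s]); move: #|P : _| #|_|; clear => i c.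
  case: i => [|[|[|i]]] // _ _; rewrite ?muln1 => e; first by rewrite e.
  by rewrite (_ : c = 2) //; lia.
by apply/centP=> l Ll; have /setIP[_ /cent1P] := subsetP sLC l Ll.
Qed.

End SubgroupOfSylow.

(** The cases are: a conjugate of L lies below P, equals N_G(P), or lies above P; failing these, P
    is maximal and L is or is not a p'-group. All but the second are contradictory. *)
Lemma nonnormal_Sylow_split p G P : prime p -> p.-Sylow(G) P -> ~~ (P <| G) ->
  gamma G = 2 -> in_class_C G -> split_S3 G.
Proof.
move=> prp sylP nP g2 cC; have sPG := pHall_sub sylP.
have [H [K tc0]] := gamma2_classes g2.
have nnP : P \in nonnormal_subgroups G by rewrite nonnormalP sPG.
have [L tc] : exists L, two_classes G P L.
  have [nH nK nHK cov] := tc0.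
  case/orP: (cov P nnP) => cP; first by exists K; apply: two_classes_conj cP.
  by exists H; apply: two_classes_conj (two_classes_sym tc0) cP.
have [B /andP[cB sB]|noB] := pickP (fun B => (B \in orbit 'JG G L) && (B \subset P)).
  by case: (Sylow_over_class prp sylP (two_classes_sym (two_classes_conj (two_classes_sym tc) cB)) cC sB).
have maxP B : B \subset P -> B :!=: P -> B <| G.
  move=> sB nB; apply: (two_classes_normal tc); first exact: subset_trans sPG.
    by apply: contra nB => cB; rewrite (conj_card_eq cB sB).
  by apply/negP=> cB; have := noB B; rewrite cB sB.
have sPN : P \subset 'N_G(P)%G by rewrite subsetI sPG normG.
have nN : ~~ ('N_G(P)%G <| G) by apply: Sylow_normalizer_nonnormal sylP nP sPN (subxx _).
have [eN|cN|/idPn//] := two_classes_overgroup tc sPN (subsetIl _ _); last first.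
  apply: (big_normalizer_split prp sylP nP maxP); last exact: cC.
    apply/eqP=> /val_inj e; move: cN; rewrite e; apply/negP.
    by have [_ _ + _] := two_classes_sym tc.
  exact: two_classes_sym (two_classes_conj (two_classes_sym tc) cN).
have NP : 'N_G(P) = P := congr1 val eN.
have [B /andP[cB sB]|noB'] := pickP (fun B => (B \in orbit 'JG G L) && (P \subset B)).
  have tcB := two_classes_sym (two_classes_conj (two_classes_sym tc) cB).
  by case: (self_normalizing_not_over prp sylP nP NP tcB cC maxP sB).
have nPL B : B \in orbit 'JG G L -> ~~ (P \subset B).
  by move=> cB; have := noB' B; rewrite cB => /= ->.
have [p'L|p'L] := boolP (p^'.-group L).
  by case: (self_normalizing_p' prp sylP nP NP tc cC nPL p'L).
by case: (self_normalizing_mixed prp sylP nP NP tc maxP nPL p'L).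
Qed.

End NonnormalSylow.

(** * Nilpotent groups: incomparable classes *)

Section Nilpotent.

Variable gT : finGroupType.
Implicit Types A B C D E F G H K L M N P Q R S T X Y Z : {group gT}.

(** B is cyclic; if its p-part and p'-part were both proper, they would be normal, and so would
    their product B. *)
Lemma pgroup_of_proper_normal G B : B \subset G -> ~~ (B <| G) ->
  (forall C, C \subset B -> C :!=: B -> C <| G) -> exists2 p, prime p & p.-group B.
Proof.
move=> sBG nB min; have /cyclicP[x eB] := cyclic_of_proper_normal sBG nB min.
have ntB := nontrivial_nonnormal nB.
have [/eqP|[p prp dvp]] := trivgVpdiv B; first by rewrite (negPf ntB).
exists p => //.
have s pi : <[x.`_pi]> \subset B by rewrite eB cycle_subG cycle_constt.
have [e|n1] := eqVneq <[x.`_p]> B; first by rewrite -e; exact: (p_elt_constt p x).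
have [e|n2] := eqVneq <[x.`_p^']> B.
  have p'B : p^'.-group B by rewrite -e; exact: (p_elt_constt p^' x).
  by have := pgroupP p'B _ prp dvp; rewrite !inE eqxx.
have nM : <[x.`_p]> * <[x.`_p^']> <| G.
  exact: (normalM (min <[x.`_p]>%G (s _) n1) (min <[x.`_p^']>%G (s _) n2)).
case/negP: nB; suff -> : B = <[x.`_p]> * <[x.`_p^']> :> {set gT} by [].
apply/eqP; rewrite eqEsubset mul_subG ?s // andbT.
have com : commute x.`_p x.`_p^' by rewrite /commute; apply: (centsP (cycle_abelian x));
  apply: cycle_constt.
have e : <[x.`_p]> <*> <[x.`_p^']> = <[x.`_p]> * <[x.`_p^']>.
  by rewrite cent_joinEr // cent_cycle cycle_subG; apply/cent1P.
by rewrite -e {1}eB cycle_subG -{1}(consttC p x) groupM // mem_gen // inE cycle_id ?orbT.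
Qed.

Lemma nilpotent_proper_normal G B : nilpotent G -> B \subset G -> ~~ (B <| G) ->
  exists M, [/\ M <| G, M :!=: G & B \subset M].
Proof.
move=> nilG sBG nB; have := nilpotent_subnormal nilG sBG.
case/subnormalEr=> [e|[M [sn nM pM]]].
  by case/negP: nB; rewrite e normal_refl.
by exists M; rewrite nM (subnormal_sub sn) (proper_neq pM).
Qed.

(** A proper normal subgroup above K contains both classes, against [class_C_normal_cover]. *)
Lemma two_classes_nested G H K : nilpotent G -> two_classes G H K -> in_class_C G ->
  H \subset K -> False.
Proof.
move=> nilG tc cC sHK; have [sKG nK] := two_classes_sub (two_classes_sym tc).
have [M [nM nMG sKM]] := nilpotent_proper_normal nilG sKG nK.
case/eqP: nMG; apply: (class_C_normal_cover cC nM) => B sBG npB.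
have nB : ~~ (B <| G) by apply: contraL npB => /normal_nonperm->.
have [_ _ _ cov] := tc; have := cov B; rewrite nonnormalP sBG nB => /(_ isT)/orP[]cB.
  by rewrite (conjs_subnormal nM cB) (subset_trans sHK).
by rewrite (conjs_subnormal nM cB).
Qed.

(** The representatives are chosen so that they themselves fail to permute; [nonperm_crossed]
    supplies such a choice. *)
Definition crossed (p : nat) G H K :=
  [/\ p.-group G, two_classes G H K,
      forall B, B \in orbit 'JG G H -> ~~ (B \subset K),
      forall B, B \in orbit 'JG G K -> ~~ (B \subset H)
    & H * K != K * H].

Lemma crossed_sym (p : nat) G H K : crossed p G H K -> crossed p G K H.
Proof. by case=> pG tc nHK nKH com; split; rewrite // 1?eq_sym //; apply: two_classes_sym. Qed.

Lemma conjs_not_sub G H K : (forall B, B \in orbit 'JG G H -> ~~ (B \subset K)) ->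
  forall B, B \in orbit 'JG G K -> ~~ (H \subset B).
Proof.
move=> nHK B /conjsP[x Gx ->]; rewrite /= -sub_conjgV.
by apply: (nHK (H :^ x^-1)%G); apply/conjsP; exists x^-1; rewrite ?groupV.
Qed.

Lemma noncontained_proper G H K B : two_classes G H K ->
  (forall B, B \in orbit 'JG G K -> ~~ (B \subset H)) ->
  B \subset H -> B :!=: H -> B <| G.
Proof.
move=> tc nKH sB nB; have [sHG _] := two_classes_sub tc.
apply: (two_classes_normal tc); first exact: subset_trans sHG.
  by apply: contra nB => cB; rewrite (conj_card_eq cB sB).
by apply/negP=> /nKH; rewrite sB.
Qed.

Lemma noncontained_over G H K B : two_classes G H K ->
  (forall B, B \in orbit 'JG G H -> ~~ (B \subset K)) ->
  H \subset B -> B \subset G -> B :!=: H -> B <| G.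
Proof.
move=> tc nHK sHB sBG nB; apply: (two_classes_normal tc) => //.
  by apply: contra nB; rewrite conjs_sym => cB; rewrite -(conj_card_eq cB sHB).
by apply/negP=> /(conjs_not_sub nHK); rewrite sHB.
Qed.

(** Otherwise HF is normal, and since K absorbs F, HK = (HF)K = K(HF) = KH. *)
Lemma crossed_normal_sub (p : nat) G H K F : crossed p G H K -> F <| G -> F \subset K ->
  F \subset H.
Proof.
case=> pG tc nHK nKH com nF sFK.
have [sHG nH] := two_classes_sub tc; have [sKG nK] := two_classes_sub (two_classes_sym tc).
have e : H <*> F = H * F by rewrite norm_joinEl // (subset_trans sHG (normal_norm nF)).
have sJ : H <*> F \subset G by rewrite join_subG sHG normal_sub.
have [eJ|nJ] := eqVneq (H <*> F) H; first by rewrite -eJ joing_subr.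
have nHF := noncontained_over tc nHK (joing_subl H F) sJ nJ.
case/eqP: com.
have eFK : F * K = K by rewrite mulSGid.
have eKF : K * F = K by rewrite mulGSid.
rewrite -{1}eFK mulgA -e -(normC (subset_trans sKG (normal_norm nHF))) /= e.
by rewrite (normC (subset_trans sHG (normal_norm nF))) mulgA eKF.
Qed.

(** The maximal subgroups of H and K are normal in G, so each lies in the other group and, being a
    proper subgroup there, in its maximal subgroup. *)
Lemma crossed_frattini p G H K : prime p -> crossed p G H K -> exists F,
  [/\ F <| G, [/\ F \subset H, cyclic H, (#|H| = p * #|F|)%N & forall B, B \subset H ->
    (B \subset F) = (B :!=: H)]
    & [/\ F \subset K, cyclic K, (#|K| = p * #|F|)%N & forall B, B \subset K ->
      (B \subset F) = (B :!=: K)]].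
Proof.
move=> prp cr; have cr' := crossed_sym cr.
have [pG tc nHK nKH com] := cr; have tc' := two_classes_sym tc.
have [sHG nH] := two_classes_sub tc; have [sKG nK] := two_classes_sub tc'.
have pH := pgroupS sHG pG; have pK := pgroupS sKG pG.
have cycH := cyclic_of_proper_normal sHG nH (fun B => noncontained_proper tc nKH).
have cycK := cyclic_of_proper_normal sKG nK (fun B => noncontained_proper tc' nHK).
have [F1 [s1 o1 m1]] := cyclic_pgroup_max pH cycH (nontrivial_nonnormal nH).
have [F2 [s2 o2 m2]] := cyclic_pgroup_max pK cycK (nontrivial_nonnormal nK).
have n1 : F1 <| G by apply: (noncontained_proper tc nKH s1); rewrite -m1.
have n2 : F2 <| G by apply: (noncontained_proper tc' nHK s2); rewrite -m2.
have s21 : F2 \subset H := crossed_normal_sub cr n2 s2.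
have s12 : F1 \subset K := crossed_normal_sub cr' n1 s1.
have e : F1 = F2.
  apply/val_inj/eqP; rewrite /= eqEsubset m1 // m2 //.
  apply/andP; split; [apply: contra nK | apply: contra nH] => /eqP <- //.
by exists F1; split=> //; rewrite e.
Qed.

End Nilpotent.

(** * A central layer of order p above the common maximal subgroup *)

Section Crossed.

Variable gT : finGroupType.
Implicit Types A B C D E F G H K L M N P Q R S T X Y Z : {group gT}.

Lemma central_layer p G F : prime p -> p.-group G -> F <| G -> F :!=: G -> exists D,
  [/\ D <| G, F \subset D, (#|D| = p * #|F|)%N & D / F \subset 'Z(G / F)].
Proof.
move=> prp pG nF nFG; have pQ : p.-group (G / F) := quotient_pgroup F pG.
have ntQ : G / F != 1.
  by rewrite -subG1 quotient_sub1 ?normal_norm //; apply: contra nFG => s;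
    rewrite eqEsubset normal_sub.
have ntZ : 'Z(G / F) != 1 by rewrite center_nil_eq1 // (pgroup_nil pQ).
have [_ dvZ _] := pgroup_pdiv (pgroupS (center_sub _) pQ) ntZ.
have [z Zz oz] := Cauchy prp dvZ.
have sz : <[z]> \subset 'Z(G / F) by rewrite cycle_subG.
exists (coset F @*^-1 <[z]>)%G; split.
- by rewrite -[X in _ <| X](quotientGK nF) cosetpre_normal sub_center_normal.
- exact: sub_cosetpre.
- by rewrite card_cosetpre -orderE oz mulnC.
by rewrite cosetpreK.
Qed.

Lemma index_prime_normal (p : nat) G M B : p.-group G -> M \subset G -> B \subset M ->
  (#|M| = p * #|B|)%N ->
  prime p -> B <| M.
Proof.
move=> pG sMG sBM oM prp; apply: (p_maximal_normal (pgroupS sMG pG)).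
by apply: p_index_maximal; rewrite // -divgS // oM mulnK.
Qed.

(** H has index p in HD and is normal there, so K is not in HD: it would normalize H. Thus the
    normal subgroup HD contains conjugates of H only, and class C yields the equation. *)
Lemma crossed_layer p G H K F D : prime p -> crossed p G H K -> in_class_C G ->
    F \subset H -> (#|H| = p * #|F|)%N -> (forall B, B \subset H -> (B \subset F) = (B :!=: H)) ->
    #|K| = #|H| -> D <| G -> F \subset D -> (#|D| = p * #|F|)%N ->
  [/\ [/\ H <*> D <| G, (#|H <*> D| = p * (p * #|F|))%N, H :&: D = F & H <| H <*> D],
      ~~ (K \subset H <*> D), 0 < nonperm G H
    & (#|orbit 'JG G H| * #|subgroups H| = #|subgroups (H <*> D)|)%N].
Proof.
move=> prp cr cC sFH oH maxF oK nD sFD oD; have [pG tc nHK nKH com] := cr.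
have [sHG nH] := two_classes_sub tc; have [sKG nK] := two_classes_sub (two_classes_sym tc).
have p1 := prime_gt1 prp.
have sDG := normal_sub nD.
have nDH : D :!=: H by apply: contra nH => /eqP<-.
have oDH : #|D| = #|H| by rewrite oD oH.
have nsHD : ~~ (H \subset D) by apply: contra nDH => s; rewrite eq_sym eqEcard s oDH leqnn.
have HID : H :&: D = F.
  have nI : H :&: D != H by apply: contra nsHD => /eqP <-; apply: subsetIr.
  by apply/eqP; rewrite eqEsubset subsetI sFH sFD (maxF (H :&: D)%G) ?subsetIl //= nI.
have e : H <*> D = H * D by rewrite norm_joinEl // (subset_trans sHG (normal_norm nD)).
have oHD : (#|H <*> D| = p * (p * #|F|))%N.
  have := mul_cardG H D; rewrite HID -e oD oH => /eqP.
  by rewrite mulnA eqn_pmul2r // mulnAC => /eqP <-; rewrite mulnA mulnAC.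
have sHJ : H \subset H <*> D := joing_subl H D.
have sJG : H <*> D \subset G by rewrite join_subG sHG.
have nHJ : H <| H <*> D by apply: (index_prime_normal pG sJG) prp; rewrite // oHD oH.
have nJG : H <*> D <| G.
  apply: (noncontained_over tc nHK sHJ sJG) => /=; apply/eqP => eJ.
  move: oHD; rewrite eJ -oH => /eqP; rewrite -{1}[#|H|]mul1n eqn_pmul2r //.
  by rewrite eq_sym gtn_eqF.
have nKJ : ~~ (K \subset H <*> D).
  apply: contra com => sKJ; apply/eqP/esym/normC.
  exact: subset_trans sKJ (normal_norm nHJ).
have nonH : 0 < nonperm G H by apply: nonperm_gt0 sKG com.
split=> //.
have dJ : defect G (H <*> D)%G = (#|orbit 'JG G H| * nonperm G H)%N.
  by rewrite (defect_two_classes tc sJG) (nconj_normal nJG sHJ) nconj_normal0 ?mul0n ?addn0.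
have h1 := card_conjs_gt1 sHG nH.
have dJ0 : 0 < defect G (H <*> D)%G by rewrite dJ muln_gt0 nonH ltnW.
have minH C : C \subset H -> C :!=: H -> nonperm G C = 0.
  by move=> sC nC; apply: normal_nonperm; apply: noncontained_proper tc nKH sC nC.
have := class_C_ratio cC sHG sJG nonH minH dJ0.
by rewrite dJ mulnAC mulnC => /eqP; rewrite eqn_pmul2l // => /eqP.
Qed.

End Crossed.

(** * Recognizing a cyclic 2-group by its number of subgroups *)

Section CrossedFalse.

Variable gT : finGroupType.
Implicit Types A B C D E F G H K L M N P Q R S T X Y Z : {group gT}.

(** Each A in F gives [A <*> <[u]>], which is not in F and meets F in A. *)
Lemma card_subgroups_index2_split D F u : F \subset D -> u \in D -> u \notin F -> u ^+ 2 = 1 ->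
  u \in 'C(F) -> 2 * #|subgroups F| <= #|subgroups D|.
Proof.
move=> sFD Du nFu u2 cu.
pose f A := (A <*> <[u]>)%G.
have tiFu : F :&: <[u]> = 1.
  rewrite setIC; apply: prime_TIg; rewrite ?cycle_subG //.
  have : #[u] %| 2 by rewrite order_dvdn u2.
  rewrite -orderE dvdn_divisors // inE => /orP[/eqP/eqP|]; last by rewrite inE => /eqP->.
  by rewrite order_eq1 => /eqP u1; rewrite u1 group1 in nFu.
have fK A : A \subset F -> f A :&: F = A.
  move=> sA; have cA : <[u]> \subset 'C(A).
    by rewrite cycle_subG; apply: subsetP cu; apply: centS.
  by rewrite /= cent_joinEr // -group_modl // [<[u]> :&: F]setIC tiFu mulg1.
have injf : {in subgroups F &, injective f}.
  move=> A B; rewrite !mem_subgroups => sA sB e; apply/val_inj.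
  by rewrite /= -(fK A sA) -(fK B sB) e.
have nf A : ~~ (f A \subset F).
  by apply: contra nFu => s; rewrite -cycle_subG (subset_trans (joing_subr A _)).
have <- : #|[set f A | A in subgroups F] :|: subgroups F| = (2 * #|subgroups F|)%N.
  rewrite cardsU (card_in_imset injf) (_ : _ :&: _ = set0) ?cards0 ?subn0 ?addnn ?mul2n //.
  apply/setP=> B; rewrite in_setI in_set0 mem_subgroups; apply/negP=> /andP[/imsetP[A _ ->]].
  by rewrite (negPf (nf A)).
apply: subset_leq_card; apply/subsetP=> B; rewrite in_setU !mem_subgroups.
case/orP=> [/imsetP[A sA ->]|sB]; last exact: subset_trans sFD.
rewrite mem_subgroups in sA.
by rewrite join_subG (subset_trans sA sFD) cycle_subG.
Qed.

Lemma index2_div G M b c : M \subset G -> #|G : M| = 2 -> b \in G -> c \in G ->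
  b \notin M -> c \notin M -> b * c^-1 \in M.
Proof.
move=> sMG i2 Gb Gc nb nc; rewrite -mem_rcoset (rcoset_index2 sMG i2) !inE ?nb ?nc //.
Qed.

(* Pick d in D \ F: if d^2 is a square f^2 in F then d f^-1 is an involution outside
   F, excluded by the previous lemma; otherwise d^2 generates F. *)
Lemma cyclic_index2 D F : 2.-group F -> cyclic F -> F \subset D -> D \subset 'C(F) ->
  #|D| = (2 * #|F|)%N -> #|subgroups D| < 2 * #|subgroups F| -> cyclic D.
Proof.
move=> pF cycF sFD cDF oD lt.
have iDF : #|D : F| = 2 by rewrite -divgS // oD mulnK.
have [d Dd nd] : exists2 d, d \in D & d \notin F.
  by apply/subsetPn; rewrite -indexg_eq1 iDF.
have Fd2 : d ^+ 2 \in F.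
  have Dd' : d^-1 \in D by rewrite groupV.
  have nd' : d^-1 \notin F by rewrite groupV.
  by have := index2_div sFD iDF Dd Dd' nd nd'; rewrite invgK expgS expg1.
have /cyclicP[f eF] := cycF.
have Ff : f \in F by rewrite eF cycle_id.
have /cycleP[i ei] : d ^+ 2 \in <[f]> by rewrite -eF.
have com : commute d f by apply: (centsP cDF).
have [oi|ni] := boolP (odd i); last first.
  have ej : i = (i./2 * 2)%N by rewrite -{1}(odd_double_half i) (negPf ni) muln2.
  have nu : d * f ^- i./2 \notin F by rewrite groupMr // groupV groupX.
  suff u2 : (d * f ^- i./2) ^+ 2 = 1.
    have Du : d * f ^- i./2 \in D by rewrite groupM // groupV groupX // (subsetP sFD).
    have := card_subgroups_index2_split sFD Du nu u2 (subsetP cDF _ Du).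
    by rewrite leqNgt lt.
  rewrite expgMn; last by apply: commuteV; apply: commuteX.
  by rewrite ei expgVn -expgM -ej mulgV.
have sFd : F \subset <[d]>.
  have gen : generator <[f]> (f ^+ i).
    rewrite generator_coprime orderE -eF; apply: pnat_coprime pF _.
    by rewrite p'natE // dvdn2 oi.
  by rewrite -ei in gen; rewrite eF (eqP gen) cycleX.
suff -> : D :=: <[d]> by apply: cycle_cyclic.
apply/eqP; rewrite eqEsubset cycle_subG Dd andbT; apply/subsetP=> e De.
have [Fe|nFe] := boolP (e \in F); first exact: (subsetP sFd).
have := index2_div sFD iDF De Dd nFe nd => /(subsetP sFd).
by rewrite groupMr // groupV cycle_id.
Qed.

End CrossedFalse.

(** * Crossed pairs do not occur in class C *)

Section CrossedFalse.

Variable gT : finGroupType.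
Implicit Types A B C D E F G H K L M N P Q R S T X Y Z : {group gT}.

Lemma class_C_cover_two G H K M : in_class_C G -> two_classes G H K -> M <| G ->
  H \subset M -> K \subset M -> M :=: G.
Proof.
move=> cC tc nM sHM sKM; apply: (class_C_normal_cover cC nM) => B sBG npB.
have nB : ~~ (B <| G) by apply: contraL npB => /normal_nonperm->.
have [_ _ _ cov] := tc; have := cov B; rewrite nonnormalP sBG nB => /(_ isT)/orP[]cB;
  by rewrite (conjs_subnormal nM cB).
Qed.

(** The index of E :&: M in E divides p and is not 1, so it exhausts |E : F|. *)
Lemma prime_index_TI E F M p : prime p -> F \subset E -> F \subset M -> ~~ (E \subset M) ->
  #|E : F| %| p -> E :&: M = F.
Proof.
move=> prp sFE sFM nEM dv; have sFI : F \subset E :&: M by rewrite subsetI sFE.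
have := Lagrange_index (subsetIl E M) sFI => e.
have n1 : #|E : E :&: M| != 1%N.
  by rewrite indexg_eq1; apply: contra nEM => s; apply: subset_trans s (subsetIr _ _).
apply/eqP; rewrite eq_sym eqEsubset sFI -indexg_eq1.
have d1 : #|E : E :&: M| %| p by apply: dvdn_trans dv; rewrite -e dvdn_mulr.
have [_ /(_ _ d1)] := primeP prp; rewrite (negPf n1) => /eqP e1.
by move: dv; rewrite -e e1 -{2}[p]muln1 dvdn_pmul2l ?prime_gt0 // dvdn1.
Qed.

(* With c = x * y and E = F<c>: if c^p lies in F then E is normal and meets
   H<*>D in F, so c, hence y, commutes with x modulo F. *)
Lemma crossed_power p G H K F D x y : prime p -> crossed p G H K -> H :=: <[x]> -> K :=: <[y]> ->
  F <| G -> F \subset H -> F \subset K -> H <*> D <| G -> K <*> D <| G ->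
  ~~ (K \subset H <*> D) -> ~~ (H \subset K <*> D) -> (x * y) ^+ p \in F -> False.
Proof.
move=> prp [pG tc nHK nKH com] eH eK nF sFH sFK nHD nKD nK_HD nH_KD.
set c := x * y => cp.
have [sHG nH] := two_classes_sub tc; have [sKG nK] := two_classes_sub (two_classes_sym tc).
have Hx : x \in H by rewrite eH cycle_id.
have Ky : y \in K by rewrite eK cycle_id.
have Gx := subsetP sHG x Hx; have Gy := subsetP sKG y Ky.
have Gc : c \in G by rewrite groupM.
have HDx : x \in H <*> D by apply: subsetP (joing_subl H D) x Hx.
have KDy : y \in K <*> D by apply: subsetP (joing_subl K D) y Ky.
have nc1 : c \notin H <*> D by rewrite groupMl //; apply: contra nK_HD; rewrite eK cycle_subG.
have nc2 : c \notin K <*> D by rewrite groupMr //; apply: contra nH_KD; rewrite {1}eH cycle_subG.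
pose E := (F <*> <[c]>)%G.
have Ec : c \in E by apply: subsetP (joing_subr F _) c (cycle_id c).
have sFE : F \subset E := joing_subl _ _.
have sEG : E \subset G by rewrite join_subG normal_sub // cycle_subG.
have nFc : c \in 'N(F) by apply: subsetP (normal_norm nF) c Gc.
have iEF : #|E : F| %| p.
  rewrite -card_quotient; last by apply: subset_trans sEG (normal_norm nF).
  rewrite /= quotientYidl ?cycle_subG // quotient_cycle // -orderE order_dvdn.
  by rewrite -morphX //= coset_id.
(* E contains c, which lies in neither of the normal subgroups HD and KD. *)
have nE : E <| G.
  apply: (two_classes_normal tc sEG); apply/negP=> cE.
    by case/negP: nc1; apply: subsetP Ec; rewrite (conjs_subnormal (M :=
      (H <*> D)%G) nHD cE) joing_subl.
  by case/negP: nc2; apply: subsetP Ec; rewrite (conjs_subnormal (M :=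
    (K <*> D)%G) nKD cE) joing_subl.
have EID : E :&: (H <*> D) = F.
  apply: (prime_index_TI (M := (H <*> D)%G) prp sFE) iEF.
    by apply: subset_trans sFH (joing_subl _ _).
  by apply: contra nc1 => s; apply: (subsetP s).
have Fcx : [~ c, x] \in F.
  rewrite -EID inE; apply/andP; split.
    by rewrite commgEl groupM ?groupV // memJ_norm // (subsetP (normal_norm nE)).
  by rewrite commgEr groupM // memJ_norm ?groupV // (subsetP (normal_norm nHD)).
(* Since c = x y, the identity c^x = c [c, x] gives y^x = y [c, x]. *)
have Kyx : y ^ x \in K.
  have : c ^ x = c * [~ c, x] by rewrite commgEl mulKVg.
  rewrite {1 2}/c conjMg conjgE mulKg -!mulgA => /mulgI ->.
  by rewrite groupM // (subsetP sFK).
case/eqP: com; apply: normC; rewrite eH cycle_subG inE {1}eK.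
by rewrite -cycleJ cycle_subG.
Qed.

(** Commutators lie in D, which is central modulo F. For odd p this puts the p-th power of x y in F,
    contradicting [crossed_power]; for p = 2 all subgroups outside HD and KD are listed
    explicitly. *)
Lemma crossed_false p G H K : prime p -> crossed p G H K -> in_class_C G -> False.
Proof.
move=> prp cr cC; have cr' := crossed_sym cr; have [pG tc nHK nKH com] := cr.
have tc' := two_classes_sym tc; have p1 := prime_gt1 prp.
have [sHG nH] := two_classes_sub tc; have [sKG nK] := two_classes_sub tc'.
have [F [nF [sFH cycH oH maxH] [sFK cycK oK maxK]]] := crossed_frattini prp cr.
have nFG : F :!=: G by apply: contra nH => /eqP e; rewrite (_ : H = G) ?normal_refl //;
  apply/val_inj/eqP; rewrite /= eqEsubset sHG -e.
have [D [nD sFD oD cD]] := central_layer prp pG nF nFG.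
have oKH : #|K| = #|H| by rewrite oK oH.
have [[nHD oHD HID nH_HD] nK_HD nonH cH] := crossed_layer prp cr cC sFH oH maxH oKH nD sFD oD.
have [[nKD oKD KID nK_KD] nH_KD nonK cK] :=
  crossed_layer prp cr' cC sFK oK maxK (esym oKH) nD sFD oD.
have sHHD : H \subset H <*> D := joing_subl H D.
have sKKD : K \subset K <*> D := joing_subl K D.
have sDHD : D \subset H <*> D := joing_subr H D.
have sDKD : D \subset K <*> D := joing_subr K D.
have f0 := cardG_gt0 F.
have iHD : #|H <*> D : D| = p by rewrite -divgS // oHD oD mulnK // muln_gt0 ltnW.
have IHK : (H <*> D) :&: (K <*> D) = D.
  apply: (prime_index_TI (E := (H <*> D)%G) (M := (K <*> D)%G) prp sDHD sDKD); last by rewrite iHD.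
  by apply: contra nH_KD; apply: subset_trans.
have eHK : (H <*> D) * (K <*> D) = G.
  have e : (H <*> D) <*> (K <*> D) = (H <*> D) * (K <*> D).
    by apply: norm_joinEl; apply: subset_trans (normal_sub nHD) (normal_norm nKD).
  rewrite -e; apply: (class_C_cover_two (M := ((H <*> D) <*> (K <*> D))%G) cC tc).
  - by rewrite /= e normalM.
  - by rewrite (subset_trans sHHD) // joing_subl.
  by rewrite (subset_trans sKKD) // joing_subr.
have oG : #|G| = (p * (p * (p * #|F|)))%N.
  have e := mul_cardG (H <*> D) (K <*> D); rewrite eHK IHK oHD oKD oD in e.
  have pf : 0 < p * #|F| by rewrite muln_gt0 ltnW.
  apply/eqP; rewrite -(eqn_pmul2r pf) -e; apply/eqP.
  by move: #|F|; clear => f; lia.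
have iG M : M <| G -> #|M| = (p * (p * #|F|))%N -> #|G : M| = p.
  by move=> nM oM; rewrite -divgS ?normal_sub // oG oM mulnK // !muln_gt0 f0 ltnW.
have iGH := iG (H <*> D)%G nHD oHD; have iGK := iG (K <*> D)%G nKD oKD.
have dGD : G^`(1) \subset D.
  rewrite -IHK subsetI; apply/andP; split; apply: der1_min; rewrite ?normal_norm //.
    by apply: cyclic_abelian; apply: prime_cyclic; rewrite card_quotient ?normal_norm // iGH.
  by apply: cyclic_abelian; apply: prime_cyclic; rewrite card_quotient ?normal_norm // iGK.
have /cyclicP[x eH] := cycH; have /cyclicP[y eK] := cycK.
have Hx : x \in H by rewrite eH cycle_id.
have Ky : y \in K by rewrite eK cycle_id.
have Gx := subsetP sHG x Hx; have Gy := subsetP sKG y Ky.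
have ncp : (x * y) ^+ p \notin F.
  by apply/negP; apply: (crossed_power prp cr eH eK nF sFH sFK nHD nKD nK_HD nH_KD).
have NF z : z \in G -> z \in 'N(F) by apply: (subsetP (normal_norm nF)).
have iH : #|H : F| = p by rewrite -divgS // oH mulnK.
have iK : #|K : F| = p by rewrite -divgS // oK mulnK.
have iD : #|D : F| = p by rewrite -divgS // oD mulnK.
have expq B b : B \subset G -> #|B : F| = p -> b \in B -> coset F b ^+ p = 1.
  move=> sB iB Bb; rewrite -iB -card_quotient; last by apply: subset_trans sB (normal_norm nF).
  by rewrite expg_cardG // mem_quotient.
(* Modulo F, (x y)^p = x^p y^p [y, x]^C(p, 2), and p divides C(p, 2) for odd p. *)
have [p2|odd_p] := even_prime prp; last first.
  have Dz : [~ y, x] \in D by apply: (subsetP dGD); rewrite mem_commg.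
  have Gz := subsetP (normal_sub nD) _ Dz.
  have cz g : g \in G -> commute (coset F g) (coset F [~ y, x]).
    move=> Gg; apply/esym; have /centerP[_] := subsetP cD _ (mem_quotient F Dz).
    by apply; apply: mem_quotient.
  have eR : [~ coset F y, coset F x] = coset F [~ y, x] by rewrite morphR ?NF.
  case/negP: ncp; apply: coset_idr; first by apply: NF; rewrite groupX ?groupM.
  rewrite morphX ?groupM ?NF //= morphM ?NF //= expMg_Rmul eR; [|exact: cz|exact: cz].
  rewrite (expq H) // (expq K) // !mul1g.
  have /dvdnP[m ->] : p %| 'C(p, 2) by rewrite prime_dvd_bin // odd_prime_gt2.
  by rewrite mulnC expgM (expq D) ?expg1n // normal_sub.
rewrite p2 in pG oH oK oD oHD oKD oG iGH iGK iD ncp expq; set a := #|subgroups F|.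
have pF : 2.-group F := pgroupS sFH (pgroupS sHG pG).
have pD : 2.-group D := pgroupS (normal_sub nD) pG.
have cHa : #|subgroups H| = a.+1.
  by apply: card_subgroups_max => // [|B sB]; rewrite ?maxH // -maxH.
have cKa : #|subgroups K| = a.+1.
  by apply: card_subgroups_max => // [|B sB]; rewrite ?maxK // -maxK.
have orb2 L : L \subset G -> ~~ (L <| G) -> L <*> D <| G -> L <| L <*> D -> #|G : L <*> D| = 2 ->
    #|orbit 'JG G L| = 2.
  move=> sLG nL nLD nL_LD iLD; have := card_conjs_gt1 sLG nL; rewrite card_conjs.
  have sN : L <*> D \subset 'N_G(L) by rewrite subsetI normal_sub ?normal_norm.
  have := Lagrange_index (subsetIl G 'N(L)) sN; rewrite iLD => /(congr1 (dvdn #|G : 'N_G(L)|)).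
  by rewrite dvdn_mulr // => /esym/dvdn_leq; case: #|_ : _| => [|[|[|n]]] //= /(_ isT).
have hH := orb2 H sHG nH nHD nH_HD iGH; have hK := orb2 K sKG nK nKD nK_KD iGK.
rewrite hH cHa in cH; rewrite hK cKa in cK.
(* C_G(F) is normal and contains the cyclic groups H and K, so it is G. *)
have cDF : D \subset 'C(F).
  have nC : 'C_G(F)%G <| G by rewrite /normal subsetIl normsI ?normG ?norms_cent ?normal_norm.
  have sLC L : L \subset G -> F \subset L -> cyclic L -> L \subset 'C_G(F)%G.
    move=> sLG sFL cyc; rewrite subsetI sLG centsC.
    by apply: subset_trans sFL _; apply: cyclic_abelian.
  have /= e := class_C_cover_two cC tc nC (sLC H sHG sFH cycH) (sLC K sKG sFK cycK).
  by apply: subset_trans (normal_sub nD) _; rewrite -e subsetIr.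
(* The three extra subgroups are HD, H and another conjugate of H. *)
have ltD : #|subgroups D| + 3 <= #|subgroups (H <*> D)|.
  have [z Gz nz] := conjs_neq sHG nH.
  have cHz : (H :^ z)%G \in orbit 'JG G H by apply/conjsP; exists z.
  have neH : H != (H :^ z)%G by rewrite eq_sym -val_eqE.
  have sHz : H :^ z \subset H <*> D by rewrite (conjs_subnormal (M := (H <*> D)%G) nHD cHz).
  have nHD' : ~~ (H \subset D).
    by apply: contra nH_KD => s; apply: subset_trans s sDKD.
  have nHzD : ~~ (H :^ z \subset D) by rewrite (conjs_subnormal nD cHz).
  have oJ : #|H <*> D| != #|H|.
    rewrite oHD oH; move: f0; move: #|F|; clear => f f0; apply/eqP; lia.
  pose J := (H <*> D)%G.
  have nJH : J != H by apply: contra oJ => /eqP/(congr1 val)/= ->.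
  have nJHz : J != (H :^ z)%G by apply: contra oJ => /eqP/(congr1 val)/= ->; rewrite cardJg.
  have nJD : ~~ (J \subset D) by apply: contra nHD'; apply: subset_trans.
  have -> : (#|subgroups D| + 3 = #|J |: (H |: ((H :^ z)%G |: subgroups D))|)%N.
    rewrite !cardsU1 !in_setU1 !mem_subgroups (negPf nJH) (negPf nJHz) (negPf nJD) (negPf neH).
    by rewrite (negPf nHD') (negPf nHzD) /=; move: #|_|; clear => n; lia.
  apply: subset_leq_card; apply/subsetP=> B; rewrite !in_setU1 !mem_subgroups.
  by case/or4P=> [/eqP->|/eqP->|/eqP->|sB] //; apply: subset_trans sB sDHD.
have cycD : cyclic D.
  apply: (cyclic_index2 pF) => //; first exact: cyclicS cycH.
  by move: ltD; rewrite -cH -/a; clear; move: #|_| => n; lia.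
have cDa : #|subgroups D| = a.+1.
  rewrite (card_subgroups_cyclic_pgroup pD cycD) oD lognM // /a.
  by rewrite (card_subgroups_cyclic_pgroup pF (cyclicS sFH cycH)).
have a2 : 2 <= a by move: ltD; rewrite -cH cDa; clear; lia.
have maxD B : B \subset D -> ~~ (B \subset F) -> D \subset B.
  move=> sB nB; have ntD : D :!=: 1 by apply: contra nB => /eqP eD;
    rewrite (subset_trans sB) // eD sub1G.
  have [F' [sF' oF' maxF']] := cyclic_pgroup_max pD cycD ntD.
  have sFF' : F \subset F'.
    rewrite maxF' //; apply/eqP => eF.
    by move: oD f0; rewrite -eF; move: #|F|; clear => f; lia.
  have eF : F :=: F'.
    apply/eqP; rewrite eqEcard sFF' -(leq_pmul2l (isT : 0 < 2)) -oF' -oD; exact: leqnn.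
  by rewrite eF maxF' // negbK in nB; rewrite (eqP nB).
pose c := x * y.
have Gc : c \in G by rewrite groupM.
have HDx := subsetP sHHD x Hx; have KDy := subsetP sKKD y Ky.
have nc1 : c \notin H <*> D.
  by rewrite groupMl //; apply: contra nK_HD; rewrite eK cycle_subG.
have nc2 : c \notin K <*> D.
  by rewrite groupMr //; apply: contra nH_KD; rewrite {1}eH cycle_subG.
(* Elements outside both index-2 subgroups form one coset of their intersection D. *)
have both b : b \in G -> b \notin H <*> D -> b \notin K <*> D -> b * c^-1 \in D.
  move=> Gb n1 n2; rewrite -IHK inE.
  rewrite (index2_div (M := (H <*> D)%G) (normal_sub nHD) iGH) //.
  by rewrite (index2_div (M := (K <*> D)%G) (normal_sub nKD) iGK).
have Dc2 : c ^+ 2 \in D.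
  have := both c^-1; rewrite !groupV => /(_ Gc nc1 nc2).
  by rewrite -invMg groupV expgS expg1.
have sDc : D \subset <[c ^+ 2]> by apply: maxD; rewrite cycle_subG.
have sDC : D \subset <[c]> by apply: subset_trans sDc (cycleX _ _).
(* Write b = d c with d in D. Then b^2 = d^2 c^2, with d^2 in F and c^2 outside F, so b^2 generates
   D; hence d and c are powers of b. *)
have gen b : b \in G -> b \notin H <*> D -> b \notin K <*> D -> <[c]> \subset <[b]>.
  move=> Gb n1 n2; have Dd := both b Gb n1 n2; set d := b * c^-1 in Dd.
  have eb : b = d * c by rewrite mulgKV.
  have com_dc : commute d c by apply: (centsP (cycle_abelian c)); rewrite ?cycle_id ?(subsetP sDC).
  have Fd2 : d ^+ 2 \in F.
    apply: coset_idr; first by rewrite NF // groupX // (subsetP (normal_sub nD)).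
    by rewrite morphX ?NF ?(subsetP (normal_sub nD)) //= (expq D) ?normal_sub.
  have sDb : D \subset <[b ^+ 2]>.
    have eb2 : b ^+ 2 = d ^+ 2 * c ^+ 2 by rewrite eb expgMn.
    apply: maxD; rewrite cycle_subG eb2; first by rewrite groupM // (subsetP sFD).
    by rewrite groupMl.
  have sDb1 : D \subset <[b]> by apply: subset_trans sDb (cycleX _ _).
  have -> : c = d^-1 * b by rewrite eb mulKg.
  by rewrite cycle_subG groupM ?cycle_id // groupV (subsetP sDb1).
have oC : 4 * #|F| <= #|<[c]>|.
  have : 1 < #|<[c]> : D|.
    rewrite indexg_gt1; apply: contra nc1 => s.
    by apply: (subsetP sDHD); rewrite -cycle_subG.
  rewrite -(Lagrange sDC) oD; move: #|_ : _| #|F|; clear => i f i2; nia.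
(* A subgroup in neither HD nor KD has an element outside both, among u, v and u v, so it contains
   c. As c has order at least 4 |F| and |G| = 8 |F|, only two choices remain. *)
have dich B : B \subset G -> [|| B \subset H <*> D, B \subset K <*> D, B == <[c]>%G | B == G].
  move=> sB; have [//|/subsetPn[u Bu nu]] := boolP (B \subset H <*> D).
  have [//|/subsetPn[v Bv nv]] := boolP (B \subset K <*> D).
  have [b Bb [n1 n2]] : exists2 b, b \in B & b \notin H <*> D /\ b \notin K <*> D.
    have [uK|] := boolP (u \in K <*> D); last by exists u.
    have [vH|] := boolP (v \in H <*> D); last by exists v.
    exists (u * v); first exact: groupM.
    by split; [rewrite groupMr | rewrite groupMl].
  have sCB : <[c]> \subset B.
    by apply: subset_trans (gen b (subsetP sB b Bb) n1 n2) _; rewrite cycle_subG.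
  have [sBC|nBC] := boolP (B \subset <[c]>).
    by rewrite -val_eqE /= eqEsubset sBC sCB.
  rewrite /= orbC -val_eqE /= eqEcard sB /= oG -(Lagrange sCB).
  have i2 : 1 < #|B : <[c]>| by rewrite indexg_gt1.
  rewrite (leq_trans _ (leq_mul oC i2)) //.
  by move: #|F|; clear => f; lia.
have eq_np : nonperm G K = nonperm G H.
  have minH C : C \subset H -> C :!=: H -> nonperm G C = 0.
    by move=> sC nC; apply: normal_nonperm; apply: noncontained_proper tc nKH sC nC.
  have dK : defect G K = nonperm G K.
    apply: defect_minimal => C sC nC; apply: normal_nonperm.
    exact: noncontained_proper tc' nHK sC nC.
  have := class_C_ratio cC sHG sKG nonH minH; rewrite dK cHa cKa => /(_ nonK)/eqP.
  by rewrite eqn_pmul2r // => /eqP.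
have cG : #|subgroups G| = (4 * a.+1)%N.
  have minH C : C \subset H -> C :!=: H -> nonperm G C = 0.
    by move=> sC nC; apply: normal_nonperm; apply: noncontained_proper tc nKH sC nC.
  have dG : defect G G = (4 * nonperm G H)%N.
    rewrite (defect_two_classes tc (subxx G)) !(nconj_normal (normal_refl G)) // hH hK eq_np.
    by rewrite -mulnDl.
  have dG0 : 0 < defect G G by rewrite dG muln_gt0.
  have := class_C_ratio cC sHG (subxx G) nonH minH dG0.
  by rewrite dG cHa mulnAC [RHS]mulnC => /eqP; rewrite eqn_pmul2r // => /eqP.
have : #|subgroups G| <= #|subgroups (H <*> D) :|: subgroups (K <*> D)| + 2.
  apply: leq_trans (_ : _ <= #|(subgroups (H <*> D) :|: subgroups (K <*> D)) :|: [set <[c]>%G;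
    G]|) _.
    apply: subset_leq_card; apply/subsetP=> B; rewrite mem_subgroups => /dich.
    by rewrite in_setU in_set2 in_setU !mem_subgroups orbA.
  apply: leq_trans (leq_card_setU _ _) _; rewrite leq_add2l cards2.
  by case: (_ != _).
(* Each of HD and KD has 2 (a + 1) subgroups and they share a + 1, so 4 (a + 1) <= 3 (a + 1) + 2,
   against a >= 2. *)
rewrite cardsU -cH -cK cG (_ : _ :&: _ = subgroups D) ?cDa.
  by move: a2; clear; lia.
by apply/setP=> B; rewrite inE !mem_subgroups -subsetI IHK.
Qed.

End CrossedFalse.

(** * From class C to the split form *)

Section Forward.

Variable gT : finGroupType.
Implicit Types A B C D E F G H K L M N P Q R S T X Y Z : {group gT}.

(** Normalizers grow in p-groups, so N_G(H) is normal and contains all conjugates of H; these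
    permute with H, so C is conjugate to K. *)
Lemma nonperm_crossed (p : nat) G H K : p.-group G -> two_classes G H K ->
    (forall B, B \in orbit 'JG G H -> ~~ (B \subset K)) ->
    (forall B, B \in orbit 'JG G K -> ~~ (B \subset H)) ->
  0 < nonperm G H -> exists C, crossed p G H C.
Proof.
move=> pG tc nHK nKH /nonperm_gt0P[C sCG com]; exists C.
have [sHG nH] := two_classes_sub tc.
have sHN : H \subset 'N_G(H)%G by rewrite subsetI sHG normG.
have nN : 'N_G(H)%G <| G.
  apply: (noncontained_over tc nHK sHN (subsetIl _ _)).
  rewrite eq_sym; apply: proper_neq.
  have prH : H \proper G.
    by rewrite properEneq sHG andbT; apply: contra nH => /eqP/val_inj->; apply: normal_refl.
  exact (nilpotent_proper_norm (pgroup_nil pG) prH).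
have nC : ~~ (C <| G).
  by apply: contra com => nC; apply/eqP/normC/(subset_trans sHG)/normal_norm.
have cC : C \in orbit 'JG G K.
  have [_ _ _ cov] := tc; have := cov C; rewrite nonnormalP sCG nC => /(_ isT)/orP[cH|//].
  case/eqP: com; apply/esym/normC.
  by have := sHN; rewrite -(conjs_subnormal nN cH) /= subsetI => /andP[].
split=> //.
- exact: two_classes_sym (two_classes_conj (two_classes_sym tc) cC).
- move=> B cB; have /conjsP[x Gx ->] := cC.
  rewrite /= -sub_conjgV; apply: (nHK (B :^ x^-1)%G).
  by have /conjsP[y Gy ->] := cB; apply/conjsP; exists (y * x^-1); rewrite ?groupM ?groupV //;
    apply/val_inj; rewrite /= conjsgM.
by move=> B; rewrite (orbit_eqP cC); apply: nKH.
Qed.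

Lemma nilpotent_not_class_C G : nilpotent G -> gamma G = 2 -> in_class_C G -> False.
Proof.
move=> nilG g2 cC; have [H [K tc]] := gamma2_classes g2; have tc' := two_classes_sym tc.
have [B /andP[cB sB]|noHK] := pickP (fun B => (B \in orbit 'JG G H) && (B \subset K)).
  exact: two_classes_nested nilG (two_classes_conj tc cB) cC sB.
have [B /andP[cB sB]|noKH] := pickP (fun B => (B \in orbit 'JG G K) && (B \subset H)).
  exact: two_classes_nested nilG (two_classes_conj tc' cB) cC sB.
have nHK B : B \in orbit 'JG G H -> ~~ (B \subset K).
  by move=> cB; have := noHK B; rewrite cB /= => ->.
have nKH B : B \in orbit 'JG G K -> ~~ (B \subset H).
  by move=> cB; have := noKH B; rewrite cB /= => ->.
have [sHG nH] := two_classes_sub tc.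
have [p prp pH] := pgroup_of_proper_normal sHG nH (fun B => noncontained_proper tc nKH).
(* An element y of prime order r other than p commutes with H, so H is a normal Sylow subgroup of
   the normal subgroup generated by y and H, hence normal in G. *)
have pG : p.-group G.
  apply/pgroupP=> r prr dr; rewrite inE; apply: contraT => nrp.
  have [y Gy oy] := Cauchy prr dr.
  have sR : <[y]> \subset G by rewrite cycle_subG.
  have p'R : p^'.-group <[y]> by rewrite /pgroup -orderE oy pnatE.
  have co : coprime #|H| #|<[y]>| by apply: pnat_coprime pH p'R.
  have cHR : H \subset 'C(<[y]>) by apply: (sub_nilpotent_cent2 nilG sR sHG); rewrite coprime_sym.
  have e : <[y]> <*> H = <[y]> * H by rewrite cent_joinEr.
  have sJ : <[y]> <*> H \subset G by rewrite join_subG sR.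
  have tiHR : <[y]> :&: H = 1 by rewrite setIC; apply: coprime_TIg.
  have nJH : <[y]> <*> H != H.
    apply/eqP=> eJ; have : <[y]> \subset <[y]> :&: H.
      by rewrite subsetI subxx -eJ joing_subl.
    rewrite tiHR subG1 cycle_eq1 => /eqP y1.
    by have := prime_gt1 prr; rewrite -oy y1 order1.
  have nJ := noncontained_over tc nHK (joing_subr <[y]> H) sJ nJH.
  have [_ sylH] := coprime_mulGp_Hall (esym e : <[y]> * H = (<[y]> <*> H)%G) p'R pH.
  have nHJ : H <| <[y]> <*> H.
    rewrite /normal joing_subr join_subG normG andbT.
    by rewrite centsC in cHR; apply: subset_trans cHR (cent_sub _).
  case/negP: nH; apply: char_normal_trans nJ.
  by have := pcore_char p (<[y]> <*> H)%G; rewrite (normal_Hall_pcore sylH nHJ).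
have [[Y sYG dY] _] := (in_class_CP G).1 cC.
move: dY; rewrite (defect_two_classes tc sYG) addn_gt0 !muln_gt0.
case/orP=> /andP[_ np].
  by have [C cr] := nonperm_crossed pG tc nHK nKH np; apply: crossed_false prp cr cC.
by have [C cr] := nonperm_crossed pG tc' nKH nHK np; apply: crossed_false prp cr cC.
Qed.

(** If all Sylow subgroups are normal, they lie in the Fitting subgroup and generate G, which is
    then nilpotent. *)
Lemma class_C_split G : gamma G = 2 -> in_class_C G -> split_S3 G.
Proof.
move=> g2 cC; have [P /andP[/SylowP[p prp sylP] nP]|noP] :=
  pickP (fun P => Sylow G P && ~~ (P <| G)).
  exact: nonnormal_Sylow_split prp sylP nP g2 cC.
case: (nilpotent_not_class_C _ g2 cC); apply: nilpotentS (Fitting_nil G).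
rewrite -{1}(Sylow_gen G) gen_subG; apply/bigcupsP=> P sylP.
have /SylowP[p prp sylpP] := sylP.
apply: Fitting_max; last exact: pgroup_nil (pHall_pgroup sylpP).
by have := noP P; rewrite sylP => /negbFE.
Qed.

End Forward.

(** * Nonabelian groups of order 6 *)

Section Order6.

Variable gT : finGroupType.
Implicit Types A B C D E F G H K L M N P Q R S T X Y Z : {group gT}.

Lemma nonabelian6 X : #|X| = 6 -> ~~ abelian X -> exists A P,
  [/\ A <| X, #|A| = 3, P \subset X, #|P| = 2 & ~~ (P <| X)].
Proof.
move=> oX nabX.
have [x Xx ox] : {x | x \in X & #[x] = 3} by apply: Cauchy; rewrite // oX.
have [y Xy oy] : {y | y \in X & #[y] = 2} by apply: Cauchy; rewrite // oX.
have sx : <[x]> \subset X by rewrite cycle_subG.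
have sy : <[y]> \subset X by rewrite cycle_subG.
have nx : <[x]> <| X by apply: index2_normal => //; rewrite -divgS // oX -orderE ox.
exists <[x]>%G, <[y]>%G; split; rewrite // -?orderE //.
apply: contra nabX => ny.
have co : coprime #|<[x]>| #|<[y]>| by rewrite -!orderE ox oy.
have ti : <[x]> :&: <[y]> = 1 by apply: coprime_TIg.
have cxy : <[y]> \subset 'C(<[x]>) by apply: commuting_normals nx ny ti.
have e : <[x]> * <[y]> = X.
  by apply/eqP; rewrite eqEcard mul_subG //= TI_cardMg // -!orderE ox oy oX.
by rewrite -e abelianM !cycle_abelian.
Qed.

Lemma nonabelian6_subgroups X A P : #|X| = 6 -> A <| X -> #|A| = 3 -> P \subset X -> #|P| = 2 ->
  ~~ (P <| X) -> #|orbit 'JG X P| = 3 /\ #|subgroups X| = 6.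
Proof.
move=> oX nA oA sP oP nP.
have tiAP : A :&: P = 1 by apply: coprime_TIg; rewrite oA oP.
have mAP : A * P = X.
  by apply/eqP; rewrite eqEcard mul_subG ?(normal_sub nA) // (TI_cardMg tiAP) oA oP oX.
have prP : prime #|P| by rewrite oP.
have prA : prime #|A| by rewrite oA.
have pP : 2.-group P by rewrite /pgroup oP.
have dA : ~~ (2 %| #|A|) by rewrite oA.
have maxP B : B \subset P -> B :!=: P -> B <| X.
  move=> sB nB; have [|ti] := prime_subgroupVti B prP.
    by move=> s; case/negP: nB; rewrite eqEsubset sB.
  by rewrite -(setIidPl sB) ti normal1.
have [-> e] := card_subgroups_split nA sP mAP prA pP (prime_cyclic prP) dA nP maxP.
rewrite (card_subgroups_prime prP) oA in e; split=> //.
by move: e; clear; lia.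
Qed.

(** The dihedral group is a common model for X and S_3. In x^y = x^i the exponent is 2 modulo 3,
    since 0 kills x and 1 makes X abelian. *)
Lemma nonabelian6_dihedral X : #|X| = 6 -> ~~ abelian X -> X \isog [set: 'D_6].
Proof.
move=> oX nabX; have oD : #|[set: 'D_3.*2]| = 6 by rewrite card_dihedral.
rewrite isogEcard (oD : #|[set: 'D_6]| = 6) oX andbT.
have [A [P [nA oA sP oP nP]]] := nonabelian6 oX nabX.
have prA : prime #|A| by rewrite oA.
have prP : prime #|P| by rewrite oP.
have /cyclicP[x eA] := prime_cyclic prA; have /cyclicP[y eP] := prime_cyclic prP.
have ox : #[x] = 3 by rewrite orderE -eA.
have oy : #[y] = 2 by rewrite orderE -eP.
have tiAP : A :&: P = 1 by apply: coprime_TIg; rewrite oA oP.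
have nPA : P \subset 'N(A) := subset_trans sP (normal_norm nA).
have mAP : A <*> P = X.
  by rewrite norm_joinEr //; apply/eqP;
    rewrite eqEcard mul_subG ?(normal_sub nA) // (TI_cardMg tiAP) oA oP oX.
have Py : y \in P by rewrite eP cycle_id.
have Ax : x \in A by rewrite eA cycle_id.
have /cycleP[i ei] : x ^ y \in <[x]> by rewrite -eA memJ_norm // (subsetP nPA).
rewrite (@Grp_dihedral 3) //; apply/existsP; exists (x, y) => /=.
rewrite -eA -eP mAP !xpair_eqE eqxx -ox -oy !expg_order !eqxx /=.
rewrite ei -expg_mod_order ox.
have : i %% 3 < 3 by rewrite ltn_mod.
have ei' : x ^ y = x ^+ (i %% 3) by rewrite ei -{1}ox expg_mod_order.
case: (i %% 3) ei' => [|[|[|//]]] e _.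
- by move/eqP: e; rewrite conjg_eq1 => /eqP x1; move: ox; rewrite x1 order1.
- case/negP: nabX; rewrite -mAP abelianY eA eP !cycle_abelian /=.
  by rewrite cent_cycle cycle_subG; apply/cent1P; rewrite /commute [RHS]conjgC e.
by rewrite eq_sym eq_invg_mul -expgS -ox expg_order.
Qed.

End Order6.

(** * The group S_3 x Z_q *)

Lemma S3_card : #|[set: 'S_3]| = 6.
Proof. by rewrite cardsT card_Sn. Qed.

Lemma S3_nonabelian : ~~ abelian [set: 'S_3].
Proof.
apply/negP=> /centsP ab.
pose i0 : 'I_3 := inord 0; pose i1 : 'I_3 := inord 1; pose i2 : 'I_3 := inord 2.
have n01 : i0 != i1 by rewrite -val_eqE /= !inordK.
have n12 : i1 != i2 by rewrite -val_eqE /= !inordK.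
have n02 : i0 != i2 by rewrite -val_eqE /= !inordK.
have := ab (tperm i0 i1) (in_setT _) (tperm i1 i2) (in_setT _).
move/(congr1 (fun s : 'S_3 => s i0)).
rewrite !permM tpermL tpermL (tpermD (x := i1) (y := i2)) 1?eq_sym // tpermL => /eqP.
by rewrite eq_sym (negPf n12).
Qed.

Lemma setT_dprod (aT bT : finGroupType) : exists A B : {group aT * bT},
  [/\ A \x B = [set: aT * bT], [set: aT] \isog A & [set: bT] \isog B].
Proof.
exists (@pairg1 aT bT @* [set: aT])%G, (@pair1g aT bT @* [set: bT])%G; split.
- rewrite /= morphim_pairg1 morphim_pair1g (setX_dprod [set: aT]%G [set: bT]%G).
  by apply/setP=> u; rewrite !inE.
- exact: sub_isog (subsetT _) (injm_pairg1 _ _).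
exact: sub_isog (subsetT _) (injm_pair1g _ _).
Qed.

(** The type ['Z_q] has at least two elements whatever q is, hence the bound. *)
Lemma card_Z q : 1 < q -> #|[set: 'Z_q]| = q.
Proof. by move=> q1; rewrite cardsT card_ord Zp_cast. Qed.

Lemma isog_S3_dprod (gT : finGroupType) (G X R : {group gT}) :
  X \x R = G -> #|X| = 6 -> ~~ abelian X -> prime #|R| ->
  G \isog [set: 'S_3 * 'Z_(#|R|)].
Proof.
move=> dG oX nabX prR; have oZ := card_Z (prime_gt1 prR).
have [A [B [dAB iA iB]]] := setT_dprod 'S_3 'Z_(#|R|).
apply: (isog_dprod dG dAB).
  apply: isog_trans iA; apply: isog_trans (nonabelian6_dihedral oX nabX) _.
  by rewrite isog_sym; apply: nonabelian6_dihedral; rewrite ?S3_card ?S3_nonabelian.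
apply: isog_trans iB.
rewrite (isog_cyclic_card [set: 'Z_(#|R|)]%G (prime_cyclic prR)) oZ eqxx andbT.
by apply: prime_cyclic; rewrite oZ.
Qed.

Lemma isog_S3_split (gT : finGroupType) (G : {group gT}) q : prime q -> 5 <= q ->
  G \isog [set: 'S_3 * 'Z_q] -> split_S3 G.
Proof.
move=> prq q5; rewrite isog_sym => /isogP[f injf fG].
have oZ := card_Z (prime_gt1 prq).
have [A [B [dAB iA iB]]] := setT_dprod 'S_3 'Z_q.
have := injm_dprod (subxx _) injf dAB; rewrite fG => dG.
exists (f @* A)%G, (f @* B)%G.
rewrite /= !card_injm ?subsetT // -(card_isog iA) -(card_isog iB) S3_card oZ; split=> //.
by rewrite injm_abelian ?subsetT // -(isog_abelian iA) S3_nonabelian.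
Qed.

(** * From the split form to class C *)

Section Backward.

Variable gT : finGroupType.
Implicit Types A B C D E F G H K L M N P Q R S T X Y Z : {group gT}.

(** The two classes are those of P and N = P x R, which permute with the same subgroups. In any Y of
    positive defect exactly half of the subgroups are conjugates of P or N, so the ratio is always
    np(P) / 2. *)
Lemma split_class_C G : gamma G = 2 -> split_S3 G -> in_class_C G.
Proof.
move=> g2 [X [R [dG oX nabX prR R5]]].
have [_ mXR cXR tiXR] := dprodP dG.
have [nX nR] := dprod_normal2 dG.
have sXG := normal_sub nX; have sRG := normal_sub nR.
have [A [P [nA oA sPX oP nPX]]] := nonabelian6 oX nabX.
have [oXP cX] := nonabelian6_subgroups oX nA oA sPX oP nPX.
have nR2 : ~~ (2 %| #|R|) by rewrite dvdn_prime2 // ltn_eqF // (leq_trans _ R5).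
have nR3 : ~~ (3 %| #|R|) by rewrite dvdn_prime2 // ltn_eqF // (leq_trans _ R5).
have coXR : coprime #|X| #|R|.
  by rewrite oX -[6]/(2 * 3)%N coprimeMl !prime_coprime // nR2.
have oG : #|G| = (6 * #|R|)%N by rewrite -(dprod_card dG) oX.
have sPG := subset_trans sPX sXG.
have pP : 2.-group P by rewrite /pgroup oP.
have prP : prime #|P| by rewrite oP.
have sylP : 2.-Sylow(G) P.
  have iP : #|G : P| = (3 * #|R|)%N.
    by rewrite -divgS // oG oP -[6]/(3 * 2)%N mulnAC mulnK.
  by rewrite /pHall sPG pP iP p'natE // Euclid_dvdM // negb_or nR2.
have nP : ~~ (P <| G) by apply: contra nPX => nP; apply: normalS nP.
have cRP : P \subset 'C(R) by rewrite centsC; apply: subset_trans cXR (centS sPX).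
pose N := (P <*> R)%G.
have eN : P <*> R = P * R by rewrite cent_joinEr // centsC.
have sPN : P \subset N := joing_subl P R.
have sNG : N \subset G by rewrite join_subG sPG.
have sNN : N \subset 'N_G(P).
  rewrite subsetI sNG /= join_subG normG /=.
  by apply: subset_trans (cent_sub _); rewrite centsC.
have nN : ~~ (N <| G) := Sylow_normalizer_nonnormal sylP nP sPN sNN.
have tiPR : P :&: R = 1 by apply/trivgP; rewrite -tiXR setSI.
have oN : #|N| = (2 * #|R|)%N by rewrite /= eN TI_cardMg // oP.
have [H [K tc0]] := gamma2_classes g2.
have tc : two_classes G P N.
  apply: (two_classes_repl tc0); rewrite ?nonnormalP ?sPG ?sNG //.
  apply/negP=> /conjs_card; rewrite oN oP => /eqP; rewrite -{2}[2]muln1 eqn_pmul2l //.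
  by rewrite eqn_leq leqNgt prime_gt1.
have joinR Q : Q \subset X -> (Q <*> R) :&: X = Q.
  move=> sQ; rewrite norm_joinEl ?(subset_trans sQ) ?(subset_trans sXG) ?normal_norm //.
  by rewrite -group_modl // [R :&: X]setIC tiXR mulg1.
have conjPX Q : Q \in orbit 'JG G P -> Q \subset X by move=> cQ; rewrite (conjs_subnormal nX cQ).
have iN : #|G : N| = 3.
  by rewrite -divgS // oG oN -[6]/(3 * 2)%N -mulnA mulnK // muln_gt0 cardG_gt0.
(* If a nonnormal C permutes with N, then |C : N :&: C| = |NC : N| divides 3 and also |C|, which is
   2 or 2 |R|. So C lies in N and is P or N. *)
have permE C : C \subset G -> (P * C == C * P) = (N * C == C * N).
  move=> sCG; have cRC : C * R = R * C by apply: normC; apply: subset_trans sCG (normal_norm nR).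
  apply/eqP/eqP => com; first by rewrite /= eN -mulgA -cRC mulgA com mulgA.
  have [nC|nC] := boolP (C <| G); first by apply: normC; apply: subset_trans sPG (normal_norm nC).
  have [_ _ _ cov] := tc; have := cov C; rewrite nonnormalP sCG nC => /(_ isT) cC.
  have sCN : C \subset N.
    have eJ := comm_joingE com.
    have sJ : N <*> C \subset G by rewrite join_subG sNG.
    have eI : #|N <*> C : N| = #|C : N :&: C|.
      have e1 := mul_cardG N C; rewrite -eJ in e1.
      apply/eqP; rewrite -(eqn_pmul2l (cardG_gt0 N)) (Lagrange (joing_subl N C)).
      rewrite -(eqn_pmul2r (cardG_gt0 (N :&: C)%G)) -e1 -{1}(Lagrange (subsetIr N C)).
      by rewrite mulnA mulnAC.
    have d3 : #|C : N :&: C| %| 3.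
      by rewrite -eI -iN -(Lagrange_index sJ (joing_subl N C)) dvdn_mull.
    have d2 : #|C : N :&: C| %| 2 * #|R|.
      have dC : #|C : N :&: C| %| #|C| by rewrite dvdn_indexg.
      by case/orP: cC dC => /conjs_card ->; rewrite ?oP ?oN // => d; apply: dvdn_mulr.
    have co : coprime 3 (2 * #|R|) by rewrite prime_coprime // Euclid_dvdM // negb_or nR3.
    have := dvdn_gcd #|C : N :&: C| 3 (2 * #|R|)%N; rewrite d3 d2 (eqP co) dvdn1 indexg_eq1.
    by rewrite subsetI => /andP[].
  case/orP: cC => cC.
    suff -> : C = P by [].
    have : C \subset N :&: X by rewrite subsetI sCN conjPX.
    by rewrite /= joinR // => sCP; apply: conj_card_eq cC sCP.
  by rewrite (conj_card_eq cC sCN) (mulGSid sPN) (mulSGid sPN).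
have nonPN : nonperm G N = nonperm G P.
  by apply: eq_card => C; rewrite !inE; case sC: (C \subset G) => //=; rewrite permE.
have nonP := Sylow_nonperm_gt0 sylP nP.
(* Conjugates of N are the products QR with Q conjugate to P, and Q is recovered as QR :&: X. *)
have nconjN Y : nconj G N Y = ((R \subset Y) * nconj G P Y)%N.
  have conjN x : x \in G -> (N :^ x = P :^ x <*> R)%g.
    by move=> Gx; rewrite /= conjYg (normsP (normal_norm nR) x Gx).
  have [sRY|nRY] := boolP (R \subset Y); last first.
    apply: nconj_eq0 => B /conjsP[x Gx ->]; apply: contra nRY; rewrite /= -/N conjN //.
    by apply: subset_trans; apply: joing_subr.
  pose f Q := (Q <*> R)%G.
  have injf : {in [set Q in orbit 'JG G P | Q \subset Y] &, injective f}.
    move=> Q1 Q2; rewrite !inE => /andP[c1 _] /andP[c2 _] e; apply/val_inj.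
    by rewrite /= -(joinR Q1 (conjPX _ c1)) -(joinR Q2 (conjPX _ c2)) -[Q1 <*> R]/(gval (f Q1)) e.
  rewrite mul1n /nconj -(card_in_imset injf); apply: eq_card => B; rewrite inE.
  apply/andP/imsetP=> [[/conjsP[x Gx ->]]|[Q]].
    rewrite /= -/N conjN // join_subG => /andP[sPY _]; exists (P :^ x)%G.
      by rewrite inE sPY andbT; apply/conjsP; exists x.
    by apply/val_inj; rewrite /= -conjN.
  rewrite inE => /andP[/conjsP[x Gx ->] sPY ->]; rewrite join_subG sPY; split=> //.
  by apply/conjsP; exists x => //; apply/val_inj; rewrite /= -conjN.
(* The count is a product over Y :&: X and Y :&: R. The former is a conjugate of P, with 2 subgroups
   and 1 conjugate of P, or X, with 6 and 3; the latter has 2 subgroups if R lies in Y and 1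
   otherwise. *)
have half Y : Y \subset G -> 0 < nconj G P Y ->
    #|subgroups Y| = (2 * (nconj G P Y + nconj G N Y))%N.
  move=> sY /card_gt0P[Q]; rewrite inE => /andP[cQ sQY].
  have dY := coprime_dprod_sub dG coXR sY.
  have coI : coprime #|Y :&: X| #|Y :&: R|.
    apply: coprime_dvdl (cardSg (subsetIr Y X)) _.
    exact: coprime_dvdr (cardSg (subsetIr Y R)) coXR.
  have sQI : Q \subset Y :&: X by rewrite subsetI sQY conjPX.
  have sIX : Y :&: X \subset X := subsetIr Y X.
  rewrite (card_subgroups_dprod (A := (Y :&: X)%G) (B := (Y :&: R)%G) dY coI) nconjN.
  have eT : #|subgroups (Y :&: R)| = (R \subset Y).+1.
    have [sRY|nRY] := boolP (R \subset Y).
      rewrite -(card_subgroups_prime prR); apply: eq_card => B; rewrite !mem_subgroups /=.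
      by rewrite (setIidPr sRY).
    rewrite -(cards1 (1%G : {group gT})); apply: eq_card => B.
    rewrite mem_subgroups in_set1 /= setIC prime_TIg // -val_eqE /= -subG1 //.
  have eB : #|subgroups (Y :&: X)| = (2 * nconj G P Y)%N.
    have -> : nconj G P Y = nconj G P (Y :&: X)%G.
      apply: eq_card => B; rewrite !inE; case cB: (B \in _) => //=.
      by rewrite subsetI (conjPX _ cB) andbT.
    have iQ : #|X : Q| = 3 by rewrite -divgS ?conjPX // (conjs_card cQ) oP oX.
    have := Lagrange_index sIX sQI; rewrite iQ => e3.
    have d3 : #|Y :&: X : Q| %| 3 by rewrite -e3 dvdn_mull.
    have [_ /(_ _ d3)/orP[]] := primeP (isT : prime 3).
      rewrite indexg_eq1 => sIQ; have eQ : (Y :&: X)%G = Q.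
        by apply/val_inj/eqP; rewrite eqEsubset sIQ.
      have prQ : prime #|Q| by rewrite (conjs_card cQ).
      rewrite eQ (congr1 val eQ : Y :&: X = Q) (card_subgroups_prime prQ).
      by rewrite /nconj -(orbit_eqP cQ) -/(nconj G Q Q) nconj_id.
    move=> /eqP e; move: e3; rewrite e -{2}[3]mul1n => /eqP;
      rewrite eqn_pmul2r // indexg_eq1 => sXI.
    have eX : (Y :&: X)%G = X by apply/val_inj/eqP; rewrite eqEsubset sIX.
    by rewrite eX (congr1 val eX : Y :&: X = X) (nconj_Sylow sylP) // oXP cX.
  by rewrite eT eB; move: (nconj G P Y) (R \subset Y); clear => n b; lia.
have defE Y : Y \subset G -> defect G Y = ((nconj G P Y + nconj G N Y) * nonperm G P)%N.
  by move=> sY; rewrite (defect_two_classes tc sY) nonPN mulnDl.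
have halfE Y : Y \subset G -> 0 < defect G Y -> (2 * defect G Y = #|subgroups Y| * nonperm G P)%N.
  move=> sY; rewrite defE // muln_gt0 nonP andbT nconjN => nY.
  rewrite (half Y sY) ?nconjN ?mulnA //.
  by move: nY; case: (nconj G P Y) => //; rewrite muln0.
apply/in_class_CP; split.
  exists P; rewrite // defE // muln_gt0 nonP andbT nconj_id.
  by rewrite addn_gt0.
move=> Y Z sY sZ dY dZ; apply/eqP; rewrite -(eqn_pmul2l (isT : 0 < 2)) !mulnA !halfE //.
by rewrite mulnC [(#|subgroups Y| * _)%N]mulnC mulnA.
Qed.

End Backward.

Theorem theorem2p4 (gT : finGroupType) (G : {group gT}) (hG : gamma G = 2) :
  in_class_C G <->
  exists q : nat, [/\ prime q, 5 <= q & G \isog [set: 'S_3 * 'Z_q]].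
Proof.
split=> [/(class_C_split hG)[X [R [dG oX nabX prR R5]]] | [q [prq q5 iG]]].
  by exists #|R|; split=> //; apply: isog_S3_dprod dG oX nabX prR.
exact: split_class_C hG (isog_S3_split prq q5 iG).
Qed.
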